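(* Let $(\overline M,\bar g)$ be a Riemannian manifold of dimension $m+n$ with a parallel calibration $\Omega$ of rank $m\ge2$, and let $F:M\to\overline M$ be an immersed oriented $m$-dimensional submanifold with second fundamental form $B$. If $F$ is $\Omega$-calibrated, then $Q_\Omega(B)=\tilde Q_\Omega(B)=0$. Thus, if $Q_\Omega$ is $\delta$-positive at $B$ (for some $\delta>0$), then $F$ is totally geodesic. This is always the case when $n=1$.
   Context: A calibration of rank $m$ on $(\overline M,\bar g)$ is a closed $m$-form $\Omega$ with comass one: at each $p$, $|\Omega(X_1,\dots,X_m)|\le1$ for all orthonormal systems, with equality for some system; parallel means $\overline\nabla\Omega=0$. The $\Omega$-angle $\theta:M\to[0,\pi]$ is given by $\cos\theta=\Omega(X_1,\dots,X_m)$, $X_i$ a direct orthonormal frame of $T_pM$ (induced metric); $F$ is $\Omega$-calibrated if $\cos\theta=1$. With $NM$ the normal bundle, define $\Phi:TM\to NM$ and $\Psi:\wedge^2TM\to\wedge^2NM$ by $\bar g(\Phi(X),U)=\Omega(U,*X)$ and $\langle\Psi(X\wedge Y),U\wedge W\rangle=\Omega(U\wedge W,*(X\wedge Y))$, with $*:TM\to\wedge^{m-1}TM$, $*:\wedge^2TM\to\wedge^{m-2}TM$ the star operators of $M$ (for $m=2$, $\langle\Psi(dV),U\wedge W\rangle=\Omega(U\wedge W)$, $dV$ being the unit oriented bivector). For $B'\in\bigodot^2TM^*\otimes NM$ and an orthonormal basis $X_i$ of $T_pM$ let $B'_\Phi(X)=\sum_i\bar g(B'(X_i,X),\Phi(X_i))$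 and $\wedge^2B'(X\wedge Y)=\sum_iB'(X_i,X)\wedge B'(X_i,Y)$. When $\cos\theta>0$, $$\tilde Q_\Omega(B')=\|B'\|^2-\tfrac{2}{\cos\theta}\langle\Psi,\wedge^2B'\rangle,\qquad Q_\Omega(B')=\tilde Q_\Omega(B')+\tfrac1{\cos^2\theta}\|B'_\Phi\|^2,$$ where $\|B'\|^2=\sum_{ij}\|B'(X_i,X_j)\|^2$ and $\langle\Psi,\wedge^2B'\rangle=\sum_{i<k}\langle\Psi(X_i\wedge X_k),\wedge^2B'(X_i\wedge X_k)\rangle$. $Q_\Omega$ is $\delta$-positive at $B'$ if $Q_\Omega(B')\ge\delta\|B'\|^2$, $\delta>0$. Totally geodesic means $B=0$. *)

(* Defs.v *)
From mathcomp Require Export all_boot all_order all_algebra.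
From mathcomp Require Export all_classical all_reals all_analysis.
Export numFieldNormedType.Exports.

Set Implicit Arguments.
Unset Strict Implicit.
Unset Printing Implicit Defensive.

Export Order.TTheory GRing.Theory Num.Theory.
#[global] Open Scope classical_set_scope.
#[global] Open Scope ring_scope.

Section LinearAlgebra.
Variables (R : realType) (k : nat).
Implicit Types (b : 'rV[R]_k -> 'rV[R]_k -> R) (l : 'rV[R]_k -> R).

Definition basis_vec (a : 'I_k) : 'rV[R]_k := delta_mx 0 a.

Definition gram b : 'M[R]_k := \matrix_(i, j) b (basis_vec i) (basis_vec j).

(* Riesz representation: the vector u such that b u w = l w for all w, when b
   is a nondegenerate bilinear form and l a linear form. *)
Definition sharp b l : 'rV[R]_k := (\row_a l (basis_vec a)) *m invmx (gram b).

Definition multilinear m (w : ('I_m -> 'rV[R]_k) -> R) : Prop :=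
  forall (v : 'I_m -> 'rV[R]_k) (i : 'I_m) (c : R) (x y : 'rV[R]_k),
    w (dfwith v i (c *: x + y)) = c * w (dfwith v i x) + w (dfwith v i y).

Definition alternating m (w : ('I_m -> 'rV[R]_k) -> R) : Prop :=
  forall (v : 'I_m -> 'rV[R]_k) (i j : 'I_m), i != j -> v i = v j -> w v = 0.

(* Evaluation of an m-form on a list s of m vectors (the default 0 is not used). *)
Definition evals m (w : ('I_m -> 'rV[R]_k) -> R) (s : seq 'rV[R]_k) : R :=
  w (fun a => nth 0 s a).

End LinearAlgebra.

Section Smooth.
Variables (R : realType) (V W : normedModType R).

Fixpoint iter_derive (s : seq V) (f : V -> W) : V -> W :=
  if s is v :: s' then fun x => 'D_v (iter_derive s' f) x else f.

(* C^infinity on the open set U: all iterated directional derivatives exist on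
   U and are Frechet differentiable there. *)
Definition smooth_on (U : set V) (f : V -> W) : Prop :=
  forall s x, U x -> differentiable (iter_derive s f) x.

End Smooth.

(* Smooth d-manifolds without boundary, presented by a smooth atlas.
   [chart_at p] is a preferred chart around p. The tangent space of M at p is
   'rV[R]_d, a tangent vector being identified with its components in the chart
   [chart_at p]. *)
Record manifold (R : realType) (d : nat) := Manifold {
  carrier :> topologicalType ;
  atlas : Type ;
  dom : atlas -> set carrier ;
  phi : atlas -> carrier -> 'rV[R]_d ;
  psi : atlas -> 'rV[R]_d -> carrier ;
  chart_at : carrier -> atlas ;
  carrier_hausdorff : hausdorff_space carrier ;
  carrier_second_countable : @second_countable carrier ;
  chart_at_dom : forall p, dom (chart_at p) p ;
  dom_open : forall i, open (dom i) ;
  phi_open : forall i, open (phi i @` dom i) ;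
  phiK : forall i p, dom i p -> psi i (phi i p) = p ;
  phi_continuous : forall i, {within dom i, continuous (phi i)} ;
  psi_continuous : forall i, {within phi i @` dom i, continuous (psi i)} ;
  transition_smooth : forall i j,
    smooth_on (phi i @` (dom i `&` dom j)) (phi j \o psi i)
}.

Section Manifolds.
Variables (R : realType) (d : nat) (M : manifold R d).

Definition image_dom (i : atlas M) : set 'rV[R]_d := phi i @` dom i.

(* All transition maps preserve the orientation of R^d; M is then oriented by
   its atlas. *)
Definition oriented_atlas : Prop :=
  forall (i j : atlas M) x, (phi i @` (dom i `&` dom j)) x ->
    0 < \det ('J (phi j \o psi i) x).

(* The tangent vector at psi i x whose components in the chart i are v. *)
Definition tangent_of (i : atlas M) (x v : 'rV[R]_d) : 'rV[R]_d :=
  'd (phi (chart_at (psi i x)) \o psi i) x v.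

Definition metric_local (g : M -> 'rV[R]_d -> 'rV[R]_d -> R)
    (i : atlas M) (x v w : 'rV[R]_d) : R :=
  g (psi i x) (tangent_of i x v) (tangent_of i x w).

Definition form_local m (w : M -> ('I_m -> 'rV[R]_d) -> R)
    (i : atlas M) (x : 'rV[R]_d) (v : 'I_m -> 'rV[R]_d) : R :=
  w (psi i x) (fun a => tangent_of i x (v a)).

Record riemannian_metric := RiemannianMetric {
  metric :> M -> 'rV[R]_d -> 'rV[R]_d -> R ;
  metric_linear : forall p c u v w,
    metric p (c *: u + v) w = c * metric p u w + metric p v w ;
  metric_sym : forall p v w, metric p v w = metric p w v ;
  metric_pos : forall p v, v != 0 -> 0 < metric p v v ;
  metric_smooth : forall i v w,
    smooth_on (image_dom i) (fun x => metric_local metric i x v w)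
}.

Record diff_form (m : nat) := DiffForm {
  form :> M -> ('I_m -> 'rV[R]_d) -> R ;
  form_multilinear : forall p, multilinear (form p) ;
  form_alternating : forall p, alternating (form p) ;
  form_smooth : forall i v,
    smooth_on (image_dom i) (fun x => form_local form i x v)
}.

(* Christoffel symbols of the Levi-Civita connection in the chart i: the
   components at x of nabla_v w, for v, w constant in the chart i. It is given
   by the Koszul formula
   2 g (nabla_v w) z = D_v (g w z) + D_w (g v z) - D_z (g v w). *)
Definition christoffel (g : riemannian_metric) (i : atlas M)
    (x v w : 'rV[R]_d) : 'rV[R]_d :=
  let gl := metric_local g i in
  sharp (gl x) (fun z => 2^-1 *
    ('D_v (fun y => gl y w z) x + 'D_w (fun y => gl y v z) x
     - 'D_z (fun y => gl y v w) x)).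

(* d Omega = 0, evaluated on vector fields constant in a chart. *)
Definition closed_form m (Omega : diff_form m) : Prop :=
  forall (i : atlas M) x, image_dom i x -> forall v : 'I_m.+1 -> 'rV[R]_d,
    \sum_(k < m.+1) (-1) ^+ k *
      'D_(v k) (fun y => form_local Omega i y (fun a => v (lift k a))) x = 0.

(* nabla Omega = 0, i.e.
   v (Omega (w_1, ..., w_m)) = \sum_k Omega (w_1, ..., nabla_v w_k, ..., w_m),
   evaluated on vector fields constant in a chart. *)
Definition parallel (g : riemannian_metric) m (Omega : diff_form m) : Prop :=
  forall (i : atlas M) x, image_dom i x ->
  forall (v : 'rV[R]_d) (w : 'I_m -> 'rV[R]_d),
    'D_v (fun y => form_local Omega i y w) x =
    \sum_(k < m) form_local Omega i x (dfwith w k (christoffel g i x v (w k))).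

Definition orthonormal (b : 'rV[R]_d -> 'rV[R]_d -> R) m
    (v : 'I_m -> 'rV[R]_d) : Prop :=
  forall i j, b (v i) (v j) = (i == j)%:R.

Definition comass_one (g : riemannian_metric) m (Omega : diff_form m) : Prop :=
  forall p,
    (forall v, orthonormal (g p) v -> `|Omega p v| <= 1) /\
    (exists2 v, orthonormal (g p) v & `|Omega p v| = 1).

Definition calibration (g : riemannian_metric) m (Omega : diff_form m) : Prop :=
  closed_form Omega /\ comass_one g Omega.

End Manifolds.

Section Immersions.
Variables (R : realType) (m d : nat) (M : manifold R m) (N : manifold R d).

Definition coord_map (F : M -> N) (i : atlas M) (j : atlas N) :
    'rV[R]_m -> 'rV[R]_d := phi j \o F \o psi i.

Definition differential (F : M -> N) (p : M) (v : 'rV[R]_m) : 'rV[R]_d :=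
  'd (coord_map F (chart_at p) (chart_at (F p))) (phi (chart_at p) p) v.

Record immersion := Immersion {
  imm_fun :> M -> N ;
  imm_continuous : continuous imm_fun ;
  imm_smooth : forall i j,
    smooth_on (phi i @` (dom i `&` imm_fun @^-1` dom j)) (coord_map imm_fun i j) ;
  imm_injective : forall p, injective (differential imm_fun p)
}.

Variables (g : riemannian_metric N) (F : immersion).

Definition induced_metric (p : M) (X Y : 'rV[R]_m) : R :=
  g (F p) (differential F p X) (differential F p Y).

(* Orthogonal projection of T_(F p) N onto the normal space of F at p. The
   tangential part of V is dF X with g (dF X) (dF Y) = g V (dF Y) for all Y. *)
Definition normal_part (p : M) (V : 'rV[R]_d) : 'rV[R]_d :=
  V - differential F p
        (sharp (induced_metric p) (fun Y => g (F p) V (differential F p Y))).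

(* B (X, Y) is the normal part of nabla_X (dF Y), with Y extended by constant
   components in the preferred chart at p. *)
Definition second_fundamental_form (p : M) (X Y : 'rV[R]_m) : 'rV[R]_d :=
  let f := coord_map F (chart_at p) (chart_at (F p)) in
  let x := phi (chart_at p) p in
  normal_part p
    ('D_X (fun y => 'D_Y f y) x +
     christoffel g (chart_at (F p)) (f x) (differential F p X) (differential F p Y)).

Definition totally_geodesic : Prop :=
  forall p X Y, second_fundamental_form p X Y = 0.

(* Direct orthonormal bases of T_p M for the induced metric, when M has an
   oriented atlas. *)
Definition direct_orthonormal_frame (p : M) (e : 'I_m -> 'rV[R]_m) : Prop :=
  orthonormal (induced_metric p) e /\ 0 < \det (\matrix_a e a).

End Immersions.

(* The quantities below are expressed in a direct orthonormal frame e of T_p M;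
   their values do not depend on e. *)
Section CalibrationAngle.
Variables (R : realType) (m d : nat) (M : manifold R m) (N : manifold R d).
Variables (g : riemannian_metric N) (Omega : diff_form N m) (F : immersion M N).
Variables (p : M) (e : 'I_m -> 'rV[R]_m).

Local Notation dF := (differential F p).
Local Notation gN := (g (F p)).
Local Notation gM := (induced_metric g F p).

Definition cos_angle : R := Omega (F p) (fun a => dF (e a)).

(* Omega (U, *X), where
   *e_i = (-1)^i e_0 /\ .. (e_i omitted) .. /\ e_(m-1), so e_i /\ *e_i = dV. *)
Definition form_star1 (U : 'rV[R]_d) (X : 'rV[R]_m) : R :=
  \sum_(i < m) gM X (e i) * ((-1) ^+ i *
    evals (Omega (F p)) (U :: [seq dF (e j) | j <- enum 'I_m & j != i])).

(* Omega (U /\ W, *(X /\ Y)), where for i < k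
   *(e_i /\ e_k) = (-1)^(i+k+1) e_0 /\ .. (e_i, e_k omitted) .. /\ e_(m-1),
   so (e_i /\ e_k) /\ *(e_i /\ e_k) = dV. *)
Definition form_star2 (U W : 'rV[R]_d) (X Y : 'rV[R]_m) : R :=
  \sum_(i < m) \sum_(k < m | (i < k)%N)
    (gM X (e i) * gM Y (e k) - gM X (e k) * gM Y (e i)) *
    ((-1) ^+ (i + k).+1 *
     evals (Omega (F p))
       (U :: W :: [seq dF (e j) | j <- enum 'I_m & (j != i) && (j != k)])).

(* The normal vector with gN (Phi X) U = Omega (U, *X) for all normal U. *)
Definition Phi (X : 'rV[R]_m) : 'rV[R]_d :=
  normal_part g F p (sharp gN (fun U => form_star1 U X)).

(* The bivector Psi (X /\ Y) of the normal space, represented by its inner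
   products with the decomposable normal bivectors U /\ W. *)
Definition Psi (X Y : 'rV[R]_m) (U W : 'rV[R]_d) : R := form_star2 U W X Y.

Variable B : 'rV[R]_m -> 'rV[R]_m -> 'rV[R]_d.

Definition normsq : R := \sum_i \sum_j gN (B (e i) (e j)) (B (e i) (e j)).

Definition B_Phi (X : 'rV[R]_m) : R := \sum_i gN (B (e i) X) (Phi (e i)).

Definition normsq_B_Phi : R := \sum_i B_Phi (e i) ^+ 2.

(* < Psi (X /\ Y), wedge2 B (X /\ Y) >, where
   wedge2 B (X /\ Y) = \sum_i B (e_i, X) /\ B (e_i, Y). *)
Definition Psi_wedge2_at (X Y : 'rV[R]_m) : R :=
  \sum_i Psi X Y (B (e i) X) (B (e i) Y).

Definition Psi_wedge2 : R :=
  \sum_(i < m) \sum_(k < m | (i < k)%N) Psi_wedge2_at (e i) (e k).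

Definition Qtilde : R := normsq - 2 / cos_angle * Psi_wedge2.

Definition Q : R := Qtilde + normsq_B_Phi / cos_angle ^+ 2.

End CalibrationAngle.

Section Calibrated.
Variables (R : realType) (m d : nat) (M : manifold R m) (N : manifold R d).
Variables (g : riemannian_metric N) (Omega : diff_form N m) (F : immersion M N).

Definition calibrated : Prop :=
  forall p e, direct_orthonormal_frame g F p e -> cos_angle Omega F p e = 1.

Definition delta_positive (delta : R)
    (B : M -> 'rV[R]_m -> 'rV[R]_m -> 'rV[R]_d) : Prop :=
  0 < delta /\
  forall p e, direct_orthonormal_frame g F p e ->
    Q g Omega F p e (B p) >= delta * normsq g F p e (B p).

End Calibrated.

(* Main.v *)
Require Import Defs.
From mathcomp Require Import ring lra zify.

(* At a point of a calibrated submanifold |Omega| is maximal on the tangent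
   frame, so tilting one vector of the frame towards a normal vector u shows
   that Omega vanishes on u and m - 1 tangent vectors: Phi = 0. Hence, for an
   ambient vector u and a local frame v_1, ..., v_m of the submanifold, replacing
   v_k by u in Omega (v_1, ..., v_m) multiplies it by the k-th coordinate of the
   tangential part of u. Differentiating this along X at p, where Omega is
   parallel, v is orthonormal and u is normal, gives
     <B (X, v_b), u> =
       \sum_(l != b) Omega (v with v_b := u and v_l := B (X, v_l)),
   and with u = B (X, v_b), summing over b and over X = v_a yields
   ||B||^2 = 2 <Psi, wedge2 B>, i.e. Qtilde = Q = 0. In codimension one
   two normal vectors are collinear, so that Psi = 0. *)

Set Implicit Arguments.
Unset Strict Implicit.
Unset Printing Implicit Defensive.

(** * Multilinear and alternating forms *)

Section Tuples.
Variables (I : eqType) (T : Type).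
Implicit Types (v : I -> T) (i j : I) (x y : T).

Lemma dfwithE v i x j : dfwith v i x j = if j == i then x else v j.
Proof.
case: (eqVneq j i) => [->|ji]; first by rewrite dfwithin.
by rewrite dfwithout // eq_sym.
Qed.

Lemma dfwith_id v i : dfwith v i (v i) = v.
Proof. by apply/funext => a; rewrite dfwithE; case: eqP => [->|]. Qed.

Lemma dfwith_same v i x y : dfwith (dfwith v i x) i y = dfwith v i y.
Proof. by apply/funext => a; rewrite !dfwithE; case: eqP. Qed.

Lemma dfwith_comm v i j x y : i != j ->
  dfwith (dfwith v i x) j y = dfwith (dfwith v j y) i x.
Proof.
move=> ij; apply/funext => a; rewrite !dfwithE.
by case: (eqVneq a j) => [->|//]; rewrite eq_sym (negPf ij).
Qed.

End Tuples.

Lemma comp_dfwith (I : eqType) (T U : Type) (f : T -> U) (v : I -> T) i x :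
  f \o dfwith v i x = dfwith (f \o v) i (f x).
Proof. by apply/funext => a /=; rewrite !dfwithE; case: eqP. Qed.

Section Multilinear.
Variables (R : realType) (d m : nat).
Implicit Types (w : ('I_m -> 'rV[R]_d) -> R) (v : 'I_m -> 'rV[R]_d).

Lemma multilinear_dfwithP w v i : multilinear w ->
  scalar (fun x => w (dfwith v i x)).
Proof. by move=> mw c x y; rewrite mw. Qed.

End Multilinear.

Section ScalarFunctions.
Variables (R : realType) (d : nat) (f : 'rV[R]_d -> R).
Hypothesis f_lin : scalar f.

Lemma scalar0 : f 0 = 0.
Proof. by have := f_lin (-1) 0 0; rewrite scaler0 addr0 mulN1r addNr. Qed.

Lemma scalarD x y : f (x + y) = f x + f y.
Proof. by have := f_lin 1 x y; rewrite scale1r mul1r. Qed.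

Lemma scalarZ c x : f (c *: x) = c * f x.
Proof. by have := f_lin c x 0; rewrite !addr0 scalar0 addr0. Qed.

Lemma scalarB x y : f (x - y) = f x - f y.
Proof. by rewrite scalarD -scaleN1r scalarZ mulN1r. Qed.

Lemma scalar_sum n (c : 'I_n -> R) (x : 'I_n -> 'rV[R]_d) :
  f (\sum_a c a *: x a) = \sum_a c a * f (x a).
Proof.
elim/big_rec2: _ => [|a y z _ <-]; first exact: scalar0.
by rewrite f_lin.
Qed.

End ScalarFunctions.

Lemma rowE_basis (R : realType) d (x : 'rV[R]_d) :
  x = \sum_a x 0 a *: basis_vec R a.
Proof. exact: row_sum_delta. Qed.

Section Alternating.
Variables (R : realType) (d m : nat) (w : ('I_m -> 'rV[R]_d) -> R).
Hypotheses (w_lin : multilinear w) (w_alt : alternating w).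
Implicit Types (v : 'I_m -> 'rV[R]_d) (i j k : 'I_m).

Let lin v i : scalar (fun x => w (dfwith v i x)).
Proof. exact: multilinear_dfwithP. Qed.

(** Polarisation: the value with [x + y] in both slots vanishes and is expanded. *)
Lemma alternating_swap v i j x y : i != j ->
  w (dfwith (dfwith v i x) j y) = - w (dfwith (dfwith v i y) j x).
Proof.
move=> ij.
have E z : w (dfwith (dfwith v i z) j z) = 0.
  by apply: (w_alt ij); rewrite !dfwithE eqxx (negPf ij) eqxx.
have := E (x + y).
rewrite (scalarD (lin _ _)) !(dfwith_comm _ _ _ ij) !(scalarD (lin _ _)).
rewrite -!(dfwith_comm _ _ _ ij) !E add0r addr0 => /eqP.
by rewrite addr_eq0 => /eqP ->; rewrite opprK.
Qed.

Lemma alternating_dup v i j x : i != j -> v j = x -> w (dfwith v i x) = 0.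
Proof.
move=> ij vj; apply: (w_alt ij).
by rewrite !dfwithE eqxx eq_sym (negPf ij).
Qed.

(** The slots are expanded one after the other: in the induction, the slots below [r] hold linear
    combinations and the others hold vectors allowed by [P]. The set [P a] depends on the slot, so
    that one slot may hold a fixed normal vector and the rest vectors of a frame. *)
Lemma multilinear_span (P : 'I_m -> set 'rV[R]_d) n
    (e : 'I_m -> 'I_n -> 'rV[R]_d) (c : 'I_m -> 'I_n -> R) :
  (forall a b, P a (e a b)) ->
  (forall v, (forall a, P a (v a)) -> w v = 0) ->
  w (fun a => \sum_b c a b *: e a b) = 0.
Proof.
move=> Pe Pw; set u := (fun a => _).
suff S (r : nat) v : (forall a : 'I_m, if (a < r)%N then v a = u a else P a (v a)) ->
    w v = 0 by apply: (S m) => a; rewrite ltn_ord.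
elim: r v => [|r IH] v Hv; first by apply: Pw => a; have := Hv a.
case: (ltnP r m) => rm; last first.
  apply: IH => a; have := Hv a.
  by rewrite (leq_trans (ltn_ord a) rm) (leq_trans (ltn_ord a) (leqW rm)).
pose i := Ordinal rm.
have vi : v i = u i by have := Hv i; rewrite ltnSn.
rewrite -(dfwith_id v i) vi (scalar_sum (lin v i)) big1 // => b _.
rewrite IH ?mulr0 // => a; rewrite dfwithE.
case: eqVneq => [->|ai]; first by rewrite ltnn.
have := Hv a; rewrite ltnS leq_eqVlt.
suff -> : (a == r :> nat) = false by [].
by apply: contraNF ai => /eqP ar; apply/eqP/val_inj.
Qed.

End Alternating.

(** * Inner products *)

(** Used for the ambient metric at a point and for its pullback to the tangent space of the
    submanifold. *)
Definition inner_product (R : realType) d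
    (b : 'rV[R]_d -> 'rV[R]_d -> R) : Prop :=
  [/\ forall w, scalar (b^~ w), forall v w, b v w = b w v &
      forall v, v != 0 -> 0 < b v v].

Section InnerProduct.
Variables (R : realType) (d : nat) (b : 'rV[R]_d -> 'rV[R]_d -> R).
Hypothesis b_ip : inner_product b.
Implicit Types u v w x y : 'rV[R]_d.

Lemma ip_linl w : scalar (b^~ w).
Proof. by case: b_ip. Qed.

Lemma ip_sym v w : b v w = b w v.
Proof. by case: b_ip. Qed.

Lemma ip_linr w : scalar (b w).
Proof. by move=> c x y; rewrite !(ip_sym w) ip_linl. Qed.

Lemma ip_ge0 v : 0 <= b v v.
Proof.
case: b_ip => _ _ pos; have [->|/pos /ltW //] := eqVneq v 0.
by rewrite (scalar0 (ip_linr 0)).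
Qed.

Lemma ip_eq0 v : b v v = 0 -> v = 0.
Proof.
by move=> bv; apply/eqP/negPn/negP => /(match b_ip with And3 _ _ p => p v end);
  rewrite bv ltxx.
Qed.

Lemma mul_gram u w : b u w = (u *m gram b *m w^T) 0 0.
Proof.
rewrite {1}(rowE_basis w) (scalar_sum (ip_linr u)) mxE; apply: eq_bigr => j _.
rewrite !mxE mulrC; congr (_ * _).
rewrite {1}(rowE_basis u) (scalar_sum (ip_linl _)).
by apply: eq_bigr => i _; rewrite mxE.
Qed.

(** By definiteness a row vector killed by the Gram matrix is zero; [invmx] in [sharp] is then a
    genuine inverse. *)
Lemma gram_unitmx : gram b \in unitmx.
Proof.
rewrite -row_free_unit; apply/inj_row_free => u u0.
by apply: ip_eq0; rewrite mul_gram u0 mul0mx mxE.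
Qed.

Lemma sharpP (l : 'rV[R]_d -> R) w : scalar l -> b (sharp b l) w = l w.
Proof.
move=> l_lin; rewrite mul_gram /sharp mulmxKV ?gram_unitmx // mxE.
rewrite [in RHS](rowE_basis w) (scalar_sum l_lin).
by apply: eq_bigr => j _; rewrite !mxE mulrC.
Qed.

(** Since [x] is already orthogonal to the [e a], normalising it suffices. The last clause keeps the
    direction of the new vector, on which the codimension one case relies. *)
Lemma orthonormal_extend k (e : 'I_k -> 'rV[R]_d) x :
  orthonormal b e -> x != 0 -> (forall a, b x (e a) = 0) ->
  exists e' : 'I_k.+1 -> 'rV[R]_d,
    [/\ orthonormal b e', forall a, e' (lift ord_max a) = e a &
        exists c, e' ord_max = c *: x].
Proof.
move=> e_on x0 xe.
have bx : 0 < b x x by case: b_ip => _ _; apply.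
pose c := (Num.sqrt (b x x))^-1.
have cc : c * (c * b x x) = 1.
  by rewrite mulrA -expr2 exprVn sqr_sqrtr ?ltW // mulVf // gt_eqF.
exists (fun a => if unlift ord_max a is Some a' then e a' else c *: x).
split; last by exists c; rewrite unlift_none.
- move=> i j; case: unliftP => [i' ->|->]; case: unliftP => [j' ->|->].
  + by rewrite e_on (inj_eq (@lift_inj _ _)).
  + rewrite ip_sym (scalarZ (ip_linl _)) xe mulr0.
    by rewrite eq_sym (negPf (neq_lift _ _)).
  + by rewrite (scalarZ (ip_linl _)) xe mulr0 (negPf (neq_lift _ _)).
  + by rewrite (scalarZ (ip_linl _)) (scalarZ (ip_linr _)) cc eqxx.
- by move=> a; rewrite liftK.
Qed.

Lemma orthonormal_exists k : (k <= d)%N ->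
  exists e : 'I_k -> 'rV[R]_d, orthonormal b e.
Proof.
elim: k => [_|k IH kd]; first by exists (fun _ => 0) => -[].
have [e e_on] := IH (ltnW kd).
(* There are fewer vectors than dimensions, so the matrix of inner products with the [e a] has a
   nonzero left kernel, which supplies an orthogonal vector. *)
pose A : 'M[R]_(d, k) := \matrix_(i, a) b (basis_vec R i) (e a).
have /rowV0Pn [x /sub_kermxP xA x0] : kermx A != 0.
  rewrite kermx_eq0 /row_free neq_ltn; apply/orP; left.
  exact: leq_ltn_trans (rank_leq_col A) kd.
have xe a : b x (e a) = 0.
  move/rowP/(_ a): xA; rewrite !mxE => <-.
  rewrite {1}(rowE_basis x) (scalar_sum (ip_linl _)).
  by apply: eq_bigr => i _; rewrite mxE.
by have [e' [e'_on _ _]] := orthonormal_extend e_on x0 xe; exists e'.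
Qed.

Lemma orthonormal_unitmx (e : 'I_d -> 'rV[R]_d) : orthonormal b e ->
  (\matrix_a e a) \in unitmx.
Proof.
move=> e_on; rewrite -row_free_unit; apply/inj_row_free => u u0.
apply/rowP => a; rewrite mxE.
have : b (u *m \matrix_a e a) (e a) = 0 by rewrite u0 (scalar0 (ip_linl _)).
rewrite mulmx_sum_row (scalar_sum (ip_linl _)) (bigD1 a) //= big1.
  by rewrite rowK e_on eqxx mulr1 addr0.
by move=> i ia; rewrite rowK e_on (negPf ia) mulr0.
Qed.

Lemma orthonormal_expansion (e : 'I_d -> 'rV[R]_d) x : orthonormal b e ->
  x = \sum_a b x (e a) *: e a.
Proof.
move=> e_on; have := mulmxKV (orthonormal_unitmx e_on) x.
set y := x *m _; rewrite mulmx_sum_row => yE.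
rewrite -{1}yE; apply: eq_bigr => a _; rewrite rowK; congr (_ *: _).
rewrite -yE (scalar_sum (ip_linl _)) (bigD1 a) //= big1.
  by rewrite rowK e_on eqxx mulr1 addr0.
by move=> i ia; rewrite rowK e_on (negPf ia) mulr0.
Qed.

Lemma orthonormal_flip (e : 'I_d -> 'rV[R]_d) k : orthonormal b e ->
  orthonormal b (dfwith e k (- e k)).
Proof.
move=> e_on i j; rewrite !dfwithE -!(scaleN1r (e k)).
case: (eqVneq i k) => [->|ik]; case: (eqVneq j k) => [jk|jk].
- by rewrite (scalarZ (ip_linl _)) (scalarZ (ip_linr _)) e_on eqxx; ring.
- by rewrite (scalarZ (ip_linl _)) e_on eq_sym (negPf jk) mulr0.
- by rewrite (scalarZ (ip_linr _)) e_on jk (negPf ik) mulr0.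
- exact: e_on.
Qed.

End InnerProduct.

(** Together with the [m] orthonormal vectors, the normalised [u] forms a full orthonormal basis, in
    which [w] has a component only along [u]. *)
Lemma orthogonal_hyperplane_collinear (R : realType) m d
    (b : 'rV[R]_d -> 'rV[R]_d -> R) (e : 'I_m -> 'rV[R]_d) u w :
  d = m.+1 -> inner_product b -> orthonormal b e -> u != 0 ->
  (forall a, b u (e a) = 0) -> (forall a, b w (e a) = 0) ->
  exists c, w = c *: u.
Proof.
move=> dE; subst d => b_ip e_on u0 ue we.
have [e' [e'_on e'E [c e'c]]] := orthonormal_extend b_ip e_on u0 ue.
exists (b w (e' ord_max) * c).
rewrite {1}(orthonormal_expansion b_ip w e'_on) (bigD1 ord_max) //= big1.
  by rewrite addr0 e'c scalerA.
move=> a; case: (unliftP ord_max a) => [a' -> _|-> /eqP //].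
by rewrite e'E we scale0r.
Qed.

Lemma det_flip (R : realType) d (e : 'I_d -> 'rV[R]_d) k :
  \det (\matrix_a dfwith e k (- e k) a) = - \det (\matrix_a e a).
Proof.
set A := \matrix_a e a.
rewrite (@determinant_multilinear _ _ _ A A k (-1) 0) ?mul0r ?addr0 ?mulN1r //.
- by apply/rowP => j; rewrite !mxE dfwithE eqxx mul0r addr0 !mxE mulN1r.
- apply/matrixP => i j; rewrite !mxE dfwithE eq_sym.
  by rewrite (negPf (neq_lift _ _)).
- apply/matrixP => i j; rewrite !mxE dfwithE eq_sym.
  by rewrite (negPf (neq_lift _ _)).
Qed.

(** Changing the sign of one vector corrects a negative orientation. *)
Lemma direct_orthonormal_exists (R : realType) d
    (b : 'rV[R]_d -> 'rV[R]_d -> R) : inner_product b ->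
  exists e : 'I_d -> 'rV[R]_d, orthonormal b e /\ 0 < \det (\matrix_a e a).
Proof.
case: d b => [|d] b b_ip.
  (* In dimension zero there is no vector to flip, but the empty determinant is 1. *)
  by exists (fun _ => 0); split=> [[]//|]; rewrite det_mx00.
have [e e_on] := orthonormal_exists b_ip (leqnn _).
have := orthonormal_unitmx b_ip e_on; rewrite unitmxE unitfE.
case: ltgtP => // [e_neg|e_pos] _; last by exists e.
exists (dfwith e ord0 (- e ord0)); split; first exact: orthonormal_flip.
by rewrite det_flip oppr_gt0.
Qed.

(** * First variation of a calibrated frame *)

Section FirstVariation.
Variables (R : realType) (m d : nat) (b : 'rV[R]_d -> 'rV[R]_d -> R).
Variables (L : {linear 'rV[R]_m -> 'rV[R]_d}) (w : ('I_m -> 'rV[R]_d) -> R).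
Hypotheses (b_ip : inner_product b) (L_inj : injective L).
Hypotheses (w_lin : multilinear w) (w_alt : alternating w).
Hypothesis w_comass : forall v, orthonormal b v -> `|w v| <= 1.
Let bL X Y := b (L X) (L Y).
Hypothesis w_calibrated : forall e, orthonormal bL e ->
  0 < \det (\matrix_a e a) -> w (L \o e) = 1.

(** Pointwise model: [b] is the ambient metric, [L] the differential and [w] the calibration at one
    point. Definiteness of the pullback comes from injectivity of [L]. *)
Lemma pullback_inner_product : inner_product bL.
Proof.
split.
- by move=> Z c X Y; rewrite /bL linearP (ip_linl b_ip).
- by move=> X Y; rewrite /bL (ip_sym b_ip).
- move=> X X0; rewrite /bL lt_def (ip_ge0 b_ip) andbT.
  apply: contra X0 => /eqP /(ip_eq0 b_ip) LX; apply/eqP/L_inj.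
  by rewrite LX linear0.
Qed.

(** A negatively oriented frame becomes direct by flipping its [k]-th vector, so [w] takes the value
    1 or -1; squaring absorbs the sign. *)
Lemma calibrated_frame (e : 'I_m -> 'rV[R]_m) (k : 'I_m) :
  orthonormal bL e -> w (L \o e) ^+ 2 = 1.
Proof.
move=> e_on.
have := orthonormal_unitmx pullback_inner_product e_on.
rewrite unitmxE unitfE; case: ltgtP => // [e_neg|e_pos] _; last first.
  by rewrite w_calibrated // expr1n.
have := w_calibrated (orthonormal_flip pullback_inner_product k e_on).
rewrite det_flip oppr_gt0 => /(_ e_neg).
rewrite comp_dfwith linearN -(scaleN1r (L _)).
rewrite (scalarZ (multilinear_dfwithP _ _ w_lin)) (dfwith_id (L \o e)).
move=> E; have -> : w (L \o e) = -1 by lra.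
by rewrite sqrrN expr1n.
Qed.

(* Tilting the k-th vector of a calibrated frame towards a normal vector u, the
   derivative of w at the tangent frame vanishes since |w| is maximal there. *)
Lemma calibrated_frame_normal (e : 'I_m -> 'rV[R]_m) (k : 'I_m) u :
  orthonormal bL e -> (forall X, b u (L X) = 0) ->
  w (dfwith (L \o e) k u) = 0.
Proof.
move=> e_on u_normal; set t := w _.
have u_normal' X : b (L X) u = 0 by rewrite (ip_sym b_ip).
pose N := b u u.
have N0 : 0 <= N by exact: ip_ge0.
set eps := w (L \o e).
have eps1 : eps ^+ 2 = 1 by exact: calibrated_frame.
(* The unit vector in the direction [L (e k) + s u] replaces the [k]-th vector; comass one, squared
   and cleared of denominators, gives this inequality. *)
have key s : (eps + s * t) ^+ 2 <= 1 + s ^+ 2 * N.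
  have r0 : 0 < 1 + s ^+ 2 * N.
    by rewrite ltr_wpDr ?ltr01 // mulr_ge0 // sqr_ge0.
  pose r := Num.sqrt (1 + s ^+ 2 * N).
  have rr : r ^+ 2 = 1 + s ^+ 2 * N by rewrite sqr_sqrtr // ltW.
  have rn0 : r != 0 by rewrite gt_eqF // sqrtr_gt0.
  pose v := dfwith (L \o e) k (r^-1 *: (s *: u + L (e k))).
  have lin i := ip_linl b_ip i; have linr i := ip_linr b_ip i.
  have on_v : orthonormal b v.
    move=> i j; rewrite /v !dfwithE.
    case: (eqVneq i k) => [ik|ik]; case: (eqVneq j k) => [jk|jk].
    - rewrite ik jk eqxx !(scalarZ (lin _)) !(scalarZ (linr _)) !(lin _) !(linr _).
      rewrite u_normal u_normal' -/N.
      have -> : b (L (e k)) (L (e k)) = 1 by have := e_on k k; rewrite eqxx.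
      have -> : r^-1 * (r^-1 * (s * (s * N + 0) + (s * 0 + 1))) =
                r^-1 ^+ 2 * (1 + s ^+ 2 * N) by ring.
      by rewrite -rr exprVn mulVf // sqrf_eq0.
    - rewrite (scalarZ (lin _)) (lin _) u_normal.
      have := e_on k j; rewrite /bL => ->.
      by rewrite ik eq_sym (negPf jk) !mulr0 addr0 mulr0.
    - rewrite (scalarZ (linr _)) (linr _) u_normal'.
      have := e_on i k; rewrite /bL => ->.
      by rewrite jk (negPf ik) !mulr0 addr0 mulr0.
    - exact: e_on.
  have := w_comass on_v; rewrite /v (scalarZ (multilinear_dfwithP _ _ w_lin)).
  rewrite (multilinear_dfwithP _ _ w_lin) (dfwith_id (L \o e)) -/t -/eps.
  rewrite -ler_sqr ?nnegrE // expr1n -normrX ger0_norm ?sqr_ge0 // exprMn exprVn.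
  by rewrite mulrC rr ler_pdivrMr // mul1r addrC.
(* With this [s] the first-order term [2 eps s t] equals [2 t^2 / (N + 1)], which exceeds the
   quadratic error [s^2 N] unless [t = 0]. Adding 1 keeps the divisor positive even if [u = 0]. *)
have := key (eps * t / (N + 1)).
set q := (N + 1)^-1.
have q0 : 0 < q by rewrite invr_gt0 ltr_wpDl.
have qN : q * (N + 1) = 1 by rewrite mulVf // gt_eqF // ltr_wpDl.
move=> H; apply/eqP; rewrite -sqrf_eq0 eq_le sqr_ge0 andbT.
have {H} : 1 + 2 * t ^+ 2 * q + t ^+ 4 * q ^+ 2 <= 1 + t ^+ 2 * q ^+ 2 * N.
  have -> : 1 + 2 * t ^+ 2 * q + t ^+ 4 * q ^+ 2 =
    eps ^+ 2 + 2 * eps ^+ 2 * t ^+ 2 * q + eps ^+ 2 * t ^+ 4 * q ^+ 2.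
    by rewrite eps1; ring.
  have -> : 1 + t ^+ 2 * q ^+ 2 * N = 1 + eps ^+ 2 * t ^+ 2 * q ^+ 2 * N.
    by rewrite eps1; ring.
  by move: H; congr (_ <= _); ring.
have -> : t ^+ 2 * q ^+ 2 * N = t ^+ 2 * q * (q * (N + 1)) - t ^+ 2 * q ^+ 2.
  by ring.
rewrite qN => H.
have : t ^+ 2 * q <= 0.
  have := sqr_ge0 (t ^+ 2 * q); have := sqr_ge0 (t * q); move: H.
  have -> : t ^+ 4 * q ^+ 2 = (t ^+ 2 * q) ^+ 2 by ring.
  have -> : t ^+ 2 * q ^+ 2 = (t * q) ^+ 2 by ring.
  by move=> *; lra.
by rewrite pmulr_lle0.
Qed.

(** Frames suffice: after expanding the [Y a] in an orthonormal frame [e], the tangential slots hold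
    vectors [L (e (s a))]. If [s] repeats a value outside [k], alternation gives zero; otherwise [s]
    can be changed at [k] into a permutation, and the permuted frame is orthonormal, whatever its
    orientation. *)
Lemma calibrated_normal (Y : 'I_m -> 'rV[R]_m) (k : 'I_m) u :
  (forall X, b u (L X) = 0) -> w (dfwith (L \o Y) k u) = 0.
Proof.
move=> u_normal.
have bL_ip := pullback_inner_product.
have [e e_on] := orthonormal_exists bL_ip (leqnn m).
pose gen a c := if a == k then u else L (e c).
(* In slot [k] the combination has a single nonzero coefficient, equal to 1, so that it reduces to
   [u]. *)
pose coef a c := if a == k then (c == k)%:R else bL (Y a) (e c).
have -> : dfwith (L \o Y) k u = fun a => \sum_c coef a c *: gen a c.
  apply/funext => a; rewrite dfwithE /coef /gen; case: (eqVneq a k) => [_|_].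
    rewrite (bigD1 k) //= eqxx scale1r big1 ?addr0 // => c /negPf ->.
    by rewrite scale0r.
  rewrite /= {1}(orthonormal_expansion bL_ip (Y a) e_on) linear_sum.
  by apply: eq_bigr => c _; rewrite linearZ.
pose P a := [set x | if a == k then x = u else exists c, x = L (e c)].
apply: (multilinear_span w_lin (P := P)) => [a c|v Pv].
  by rewrite /P /gen /=; case: eqP => _ //; exists c.
have /choice [s sE] a : exists c, a != k -> v a = L (e c).
  have := Pv a; rewrite /P /=; case: eqVneq => [|_ [c]]; first by exists k.
  by exists c.
have -> : v = dfwith (L \o (e \o s)) k u.
  apply/funext => a; rewrite dfwithE; case: eqVneq => [->|/sE //].
  by have := Pv k; rewrite /P /= eqxx.
have [s_inj|] := boolP [forall a, forall a',
    (a != k) && (a' != k) && (s a == s a') ==> (a == a')]; last first.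
  rewrite negb_forall => /existsP [a]; rewrite negb_forall => /existsP [a'].
  rewrite negb_imply => /andP [/andP [/andP [ak a'k] /eqP saa'] aa'].
  by apply: (w_alt aa'); rewrite !dfwithE (negPf ak) (negPf a'k) /= saa'.
(* The [m - 1] slots other than [k] cannot exhaust the [m] frame vectors. *)
have [c cs] : exists c, c \notin [seq s a | a in predC1 k].
  apply/existsP; rewrite -negb_forall; apply/negP => /forallP sT.
  have im : #|[seq s a | a in predC1 k]| = m.
    by rewrite -[RHS]card_ord; apply: eq_card => c; rewrite (sT c).
  have := leq_image_card s (predC1 k); rewrite im cardC1 card_ord.
  by rewrite leqNgt ltn_predL (leq_ltn_trans _ (ltn_ord k)).
have s'_inj : injective (dfwith s k c).
  move=> a a'; rewrite !dfwithE.
  case: (eqVneq a k) => [->|ak]; case: (eqVneq a' k) => [->|a'k] //.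
  - by move=> E; case/negP: cs; rewrite E fintype.image_f // !inE.
  - by move=> E; case/negP: cs; rewrite -E fintype.image_f // !inE.
  - move=> E; move/forallP/(_ a)/forallP/(_ a'): s_inj.
    by rewrite ak a'k E eqxx /= => /eqP.
(* Slot [k] holds [u], so [s] may be redefined there as the free index [c]. *)
have -> : dfwith (L \o (e \o s)) k u = dfwith (L \o (e \o dfwith s k c)) k u.
  by apply/funext => a; rewrite !dfwithE /= dfwithE; case: eqP.
apply: calibrated_frame_normal => // i j.
by rewrite /= e_on (inj_eq s'_inj).
Qed.

End FirstVariation.

(** * Replacing slots versus prepending arguments *)

Lemma uniq_split_filter (T : eqType) (x : T) (t : seq T) : uniq t -> x \in t ->
  exists t1 t2, [/\ t = t1 ++ x :: t2, [seq y <- t | y != x] = t1 ++ t2,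
    x \notin t1, x \notin t2 & size t1 = index x t].
Proof.
move=> t_uniq xt; case/splitPr: xt t_uniq => t1 t2.
rewrite cat_uniq /= => /and3P [_ /norP [x1 _] /andP [x2 _]].
exists t1, t2; split=> //.
  rewrite filter_cat /= eqxx; congr (_ ++ _); apply/all_filterP/allP => y yt.
    by apply: contraNneq x1 => <-.
  by apply: contraNneq x2 => <-.
by rewrite index_cat (negPf x1) /= eqxx addn0.
Qed.

Section EvalsSlots.
Variables (R : realType) (d m : nat) (w : ('I_m -> 'rV[R]_d) -> R).
Hypotheses (w_lin : multilinear w) (w_alt : alternating w).
Implicit Types (s : seq 'rV[R]_d) (v : 'I_m -> 'rV[R]_d) (U W x y : 'rV[R]_d).

(** The bound ensures that [w] reads both exchanged positions of the list. *)
Lemma evals_swap s1 s2 x y : ((size s1).+1 < m)%N ->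
  evals w (s1 ++ x :: y :: s2) = - evals w (s1 ++ y :: x :: s2).
Proof.
move=> lt_m; have lt_m' := ltnW lt_m.
pose i := Ordinal lt_m'; pose j := Ordinal lt_m.
have ij : i != j by rewrite -val_eqE /= neq_ltn ltnSn.
pose v := fun a : 'I_m => nth 0 (s1 ++ 0 :: 0 :: s2) a.
have E x' y' : (fun a : 'I_m => nth 0 (s1 ++ x' :: y' :: s2) a) =
    dfwith (dfwith v i x') j y'.
  apply/funext => a; rewrite !dfwithE /v !nth_cat -!val_eqE /=.
  case: ltngtP => [lt_a|gt_a|->]; rewrite ?subnn //=; last by rewrite ltn_eqF.
    by rewrite ltn_eqF // (ltn_trans lt_a).
  case: (eqVneq (a : nat) (size s1).+1) => [->|ne_a].
    by rewrite subSn ?subnn.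
  by have -> : (a - size s1 = (a - (size s1).+2).+2)%N by lia.
by rewrite /evals !E alternating_swap.
Qed.

(** Bringing [U] from position [i] to the front takes [i] adjacent swaps. *)
Lemma evals_insert s U i : (i <= size s)%N -> (i < m)%N ->
  evals w (take i s ++ U :: drop i s) = (-1) ^+ i * evals w (U :: s).
Proof.
elim: i => [|i IH] i_s i_m; first by rewrite take0 drop0 expr0 mul1r.
rewrite exprS mulN1r mulNr -(IH (ltnW i_s) (ltnW i_m)).
rewrite (take_nth 0) // cat_rcons (drop_nth 0 (n := i)) // evals_swap //.
by rewrite size_takel // ltnW.
Qed.

Lemma map_dfwith v k W (t : seq 'I_m) : uniq t -> k \in t ->
  let s := [seq v j | j <- t & j != k] in
  [seq dfwith v k W j | j <- t] = take (index k t) s ++ W :: drop (index k t) s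
  /\ (index k t <= size s)%N.
Proof.
move=> t_uniq kt /=.
have [t1 [t2 [tE -> k1 k2 <-]]] := uniq_split_filter t_uniq kt.
have E t' : k \notin t' -> [seq dfwith v k W j | j <- t'] = map v t'.
  move=> kt'; apply/eq_in_map => j jt'; rewrite dfwithE ifN //.
  by apply: contraNneq kt' => <-.
rewrite tE !map_cat /= dfwithE eqxx !E // size_cat !size_map leq_addr.
rewrite -(size_map v t1).
by rewrite take_size_cat // drop_size_cat.
Qed.

(** The right-hand side follows the convention of [form_star1], so that pairing with the star
    operator becomes replacement of a slot. *)
Lemma evals_slot1 v i U :
  w (dfwith v i U) =
    (-1) ^+ i * evals w (U :: [seq v j | j <- enum 'I_m & j != i]).
Proof.
have [E le_i] := map_dfwith v U (enum_uniq 'I_m) (mem_enum 'I_m i).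
rewrite index_enum_ord in E le_i.
rewrite -evals_insert // -E /evals; congr w; apply/funext => a.
by rewrite (nth_map a) ?size_enum_ord // nth_ord_enum.
Qed.

(** The sign counts [i] swaps for [U], then [k] swaps that bring [W] to the front, and one that puts
    [U] before [W]. *)
Lemma evals_slot2 v (i k : 'I_m) U W : (i < k)%N ->
  w (dfwith (dfwith v k W) i U) = (-1) ^+ (i + k).+1 *
    evals w (U :: W :: [seq v j | j <- enum 'I_m & (j != i) && (j != k)]).
Proof.
move=> ik; rewrite evals_slot1.
set t := [seq j <- enum 'I_m | j != i].
have t_uniq : uniq t by rewrite filter_uniq // enum_uniq.
have ki : k != i by rewrite -val_eqE gtn_eqF.
have kt : k \in t by rewrite mem_filter ki mem_enum.
(* Omitting [i < k] lowers the position of [k] by one; placing [U] in front restores it. *)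
have p : (index k t).+1 = k.
  have [t1 [t2]] := uniq_split_filter (enum_uniq 'I_m) (mem_enum 'I_m i).
  rewrite index_enum_ord -/t => -[tE -> i1 i2 s1].
  have := index_enum_ord k; rewrite tE !index_cat /= [i == k]eq_sym (negPf ki).
  case: ifPn => [k1|_]; last by move=> <-; rewrite addnS.
  by move=> k_idx; move: k1; rewrite -index_mem k_idx s1 ltnNge ltnW.
have [-> le_k] := map_dfwith v W t_uniq kt.
set s := map v _ in le_k *.
have -> : [seq v j | j <- enum 'I_m & (j != i) && (j != k)] = s.
  rewrite /s /t -filter_predI; congr map; apply: eq_filter => j /=.
  by rewrite andbC.
have := @evals_insert (U :: s) W (index k t).+1 le_k.
rewrite /= p => -> //.
rewrite (@evals_swap [::]) /=; last by rewrite (leq_ltn_trans _ (ltn_ord k)) // -p.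
by rewrite mulrA mulrN -mulNr -exprD exprS mulN1r.
Qed.

End EvalsSlots.

(** * Derivatives *)

Section Derivatives.
Variables (R : realType) (V W : normedModType R).

Lemma is_derive_ext (f g : V -> W) x v df dg :
  is_derive x v f df -> f =1 g -> df = dg -> is_derive x v g dg.
Proof. by move=> H /funext <- <-. Qed.

Lemma is_derive_fun_sum n (h : 'I_n -> V -> W) (dh : 'I_n -> W) x v :
  (forall a, is_derive x v (h a) (dh a)) ->
  is_derive x v (fun y => \sum_a h a y) (\sum_a dh a).
Proof.
move=> H; apply: (is_derive_ext (is_derive_sum H)) => // y.
by rewrite fct_sumE.
Qed.

Lemma differentiable_is_derive (f : V -> W) x v :
  differentiable f x -> is_derive x v f ('D_v f x).
Proof. by move=> df; apply/derivableP/diff_derivable. Qed.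

Lemma derive_linear (f : V -> W) x c u v : differentiable f x ->
  'D_(c *: u + v) f x = c *: 'D_u f x + 'D_v f x.
Proof. by move=> df; rewrite !deriveE // linearP. Qed.

End Derivatives.

Lemma derive_scalar (R : realType) (V : normedModType R) (f : V -> R) x c u v :
  differentiable f x -> 'D_(c *: u + v) f x = c * 'D_u f x + 'D_v f x.
Proof. exact: derive_linear. Qed.

Section Composition.
Variables (R : realType) (U V W : normedModType R).

Lemma derive_comp (f : U -> V) (g : V -> W) x v :
  differentiable f x -> differentiable g (f x) ->
  'D_v (g \o f) x = 'd g (f x) ('d f x v).
Proof.
move=> df dg; rewrite deriveE; last exact: differentiable_comp.
by rewrite diff_comp.
Qed.

Lemma is_derive_comp (f : U -> V) (g : V -> W) x v :
  differentiable f x -> differentiable g (f x) ->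
  is_derive x v (g \o f) ('D_('D_v f x) g (f x)).
Proof.
move=> df dg; have dgf := differentiable_comp df dg.
apply: (is_derive_ext (differentiable_is_derive v dgf)) => //.
by rewrite derive_comp // !deriveE.
Qed.

End Composition.

Section MultilinearDerivative.
Variables (R : realType) (V : normedModType R) (d m : nat).
Variables (w : V -> ('I_m -> 'rV[R]_d) -> R) (dw : ('I_m -> 'rV[R]_d) -> R).
Variables (x0 X : V).
Hypothesis w_lin : forall x, multilinear (w x).
Hypothesis w_derive : forall v, is_derive x0 X (w^~ v) (dw v).

(** A linear relation valid for all [x] passes to derivatives. This serves to reassemble a slot that
    was expanded in coordinates. *)
Lemma derivative_multilinear : multilinear dw.
Proof.
move=> v i c y z.
have := w_derive (dfwith v i (c *: y + z)).
have -> : w^~ (dfwith v i (c *: y + z)) =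
    (c \*: (w^~ (dfwith v i y))) + w^~ (dfwith v i z).
  by apply/funext => x; rewrite w_lin.
move=> /@derive_val <-.
have H := is_deriveD (is_deriveZ c (w_derive (dfwith v i y))) (w_derive (dfwith v i z)).
by rewrite (derive_val (is_derive := H)).
Qed.

(** Product rule when both the form and its arguments vary, from the derivatives for constant
    arguments. The induction is on the number of varying slots: the new slot is written in
    coordinates, which leaves products of scalar functions. *)
Lemma is_derive_multilinear (u : 'I_m -> V -> 'rV[R]_d) (u' : 'I_m -> 'rV[R]_d) :
  (forall a, is_derive x0 X (u a) (u' a)) ->
  is_derive x0 X (fun x => w x (u^~ x))
    (dw (u^~ x0) + \sum_a w x0 (dfwith (u^~ x0) a (u' a))).
Proof.
move=> du.
pose part (r : nat) v x := fun a : 'I_m => if (a < r)%N then u a x else v a.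
suff H (r : nat) v : (r <= m)%N -> is_derive x0 X (fun x => w x (part r v x))
    (dw (part r v x0) +
     \sum_(a < m | (a < r)%N) w x0 (dfwith (part r v x0) a (u' a))).
  have E x : part m (fun=> 0) x = u^~ x.
    by apply/funext => a; rewrite /part ltn_ord.
  apply: (is_derive_ext (H m (fun=> 0) (leqnn m))) => [x|]; rewrite E //.
  by congr (_ + _); apply: eq_bigl => a; rewrite ltn_ord.
elim: r v => [|r IH] v rm.
  rewrite big_pred0 // addr0; apply: (is_derive_ext (w_derive v)) => //.
pose i := Ordinal rm.
have partE x y : part r (dfwith v i y) x = dfwith (part r.+1 v x) i y.
  apply/funext => a; rewrite /part !dfwithE -val_eqE /= ltnS.
  case: ltngtP => // ->.
pose f c x := u i x 0 c.
pose g c x := w x (part r (dfwith v i (basis_vec R c)) x).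
have parti x : part r.+1 v x i = u i x by rewrite /part ltnSn.
have sumE x : w x (part r.+1 v x) = \sum_c f c x * g c x.
  rewrite -(dfwith_id (part r.+1 v x) i) parti {1}(rowE_basis (u i x)).
  rewrite (scalar_sum (multilinear_dfwithP _ _ (w_lin x))).
  by apply: eq_bigr => c _; rewrite /g partE.
have df c : is_derive x0 X (f c) (u' i 0 c).
  have ui : derivable (u i) x0 X := ex_derive (is_derive := du i).
  apply: (is_derive_ext (derivableP ((derivable_mxP _ _ _).1 ui 0 c))) => //.
  by rewrite -(derive_val (is_derive := du i)) derive_mx // mxE.
have dg c := IH (dfwith v i (basis_vec R c)) (ltnW rm).
apply: (is_derive_ext (is_derive_fun_sum (fun c => is_deriveM (df c) (dg c)))) => //.
set B := part r.+1 v x0.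
have BE a y : dfwith (part r (dfwith v i y) x0) a = dfwith (dfwith B i y) a.
  by rewrite partE.
transitivity (\sum_c (u' i 0 c * w x0 (dfwith B i (basis_vec R c)) +
    f c x0 * (dw (dfwith B i (basis_vec R c)) + \sum_(a < m | (a < r)%N)
      w x0 (dfwith (dfwith B i (basis_vec R c)) a (u' a))))).
  apply: eq_bigr => c _; rewrite addrC; congr (_ + _).
    by rewrite /g partE -/B; exact: mulrC.
  by rewrite partE.
(* The coordinate sums are now contracted back into vectors, by linearity of [w x0] and of [dw]. *)
have w_slot v' a := scalar_sum (multilinear_dfwithP v' a (w_lin x0)).
rewrite big_split /= -w_slot -rowE_basis.
rewrite [in RHS](bigD1 i) //= addrCA; congr (_ + _).
under eq_bigr do rewrite mulrDr; rewrite big_split /=; congr (_ + _).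
  rewrite -(scalar_sum (multilinear_dfwithP _ _ derivative_multilinear)).
  by rewrite -rowE_basis -parti dfwith_id.
under eq_bigr do rewrite mulr_sumr; rewrite exchange_big /=.
have other (a : 'I_m) : ((a < r.+1)%N && (a != i)) = (a < r)%N.
  by rewrite ltnS -val_eqE /=; case: ltngtP.
under [RHS]eq_bigl do rewrite other.
apply: eq_bigr => a ar.
have ia : i != a by rewrite -val_eqE /= gtn_eqF.
under eq_bigr do rewrite dfwith_comm //.
rewrite -w_slot -rowE_basis -parti -/B; congr (w x0 _).
apply/funext => b; rewrite !dfwithE; case: (eqVneq b i) => // ->.
by rewrite (negPf ia).
Qed.

End MultilinearDerivative.

(** * Charts and the Levi-Civita connection *)

Section Charts.
Variables (R : realType) (d : nat) (M : manifold R d).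
Implicit Types (i j : atlas M) (x : 'rV[R]_d) (p q : M).

Lemma image_dom_psi i x : image_dom i x -> dom i (psi i x) /\ phi i (psi i x) = x.
Proof. by move=> [p pi <-]; rewrite phiK. Qed.

Lemma image_dom_phi i p : dom i p -> image_dom i (phi i p).
Proof. by move=> pi; exists p. Qed.

Lemma transition_dom i j x : image_dom i x -> dom j (psi i x) ->
  (phi i @` (dom i `&` dom j)) x.
Proof. by move=> [p pi <-]; rewrite phiK // => pj; exists p. Qed.

Lemma psi_continuous_at i x : image_dom i x -> {for x, continuous (psi i)}.
Proof.
move=> xi; have := @psi_continuous _ _ M i.
rewrite continuous_open_subspace; last exact: phi_open.
by apply; rewrite inE.
Qed.

Lemma near_psi i x (O : set M) : image_dom i x -> open O -> O (psi i x) ->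
  \forall y \near x, image_dom i y /\ O (psi i y).
Proof.
move=> xi Oo Ox.
apply: filterS2 (_ : \forall y \near x, image_dom i y)
  (_ : \forall y \near x, O (psi i y)) => //.
  by apply: open_nbhs_nbhs; split=> //; exact: phi_open.
by apply: psi_continuous_at => //; apply: open_nbhs_nbhs.
Qed.

Lemma transition_differentiable i j x : image_dom i x -> dom j (psi i x) ->
  differentiable (phi j \o psi i) x.
Proof.
move=> xi xj; have := @transition_smooth _ _ M i j [::] x; apply.
exact: transition_dom.
Qed.

(** The derivative of the inverse transition provides a preimage, since the two transitions compose
    to the identity near the point. *)
Lemma tangent_of_surjective i x : image_dom i x ->
  forall Z, exists Y, tangent_of i x Y = Z.
Proof.
move=> xi Z; set c := chart_at (psi i x).
have xc : dom c (psi i x) by exact: chart_at_dom.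
have [pi phiK'] := image_dom_psi xi.
pose y := phi c (psi i x).
have yc : image_dom c y by exact: image_dom_phi.
have psiy : psi c y = psi i x by rewrite phiK.
exists ('d (phi i \o psi c) y Z); rewrite /tangent_of -/c.
have dy : differentiable (phi i \o psi c) y.
  by apply: transition_differentiable; rewrite ?psiy.
have dx : differentiable (phi c \o psi i) ((phi i \o psi c) y).
  by rewrite /= psiy phiK'; exact: transition_differentiable.
have <- : (phi i \o psi c) y = x by rewrite /= psiy.
rewrite -derive_comp //.
rewrite (@near_eq_derive _ _ _ _ id) ?derive_id //.
have := near_psi yc (dom_open (m := M) i); rewrite psiy => /(_ pi).
apply: filterS => z [zc zi] /=.
by rewrite phiK //; case: (image_dom_psi zc).
Qed.

(** The transition from a chart to itself is the identity near the point. Hence local expressions in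
    the preferred chart agree at [p] with the pointwise tensors. *)
Lemma tangent_of_chart_at p v :
  tangent_of (chart_at p) (phi (chart_at p) p) v = v.
Proof.
have pp := chart_at_dom p; set i := chart_at p in pp *.
have xi := image_dom_phi pp.
rewrite /tangent_of phiK // -/i -deriveE; last first.
  by apply: transition_differentiable; rewrite ?phiK.
rewrite (@near_eq_derive _ _ _ _ id) ?derive_id //.
have := near_psi xi (dom_open (m := M) i); rewrite phiK // => /(_ pp).
by apply: filterS => z [zc zi] /=; case: (image_dom_psi zc).
Qed.

Lemma riemannian_inner_product (g : riemannian_metric M) p : inner_product (g p).
Proof.
split; [by move=> w c u v; exact: metric_linear|exact: metric_sym|].
exact: metric_pos.
Qed.

Lemma metric_local_chart_at (g : riemannian_metric M) p v w :
  metric_local g (chart_at p) (phi (chart_at p) p) v w = g p v w.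
Proof.
by rewrite /metric_local !tangent_of_chart_at phiK //; exact: chart_at_dom.
Qed.

Lemma form_local_chart_at m (Omega : diff_form M m) p v :
  form_local Omega (chart_at p) (phi (chart_at p) p) v = Omega p v.
Proof.
rewrite /form_local phiK; last exact: chart_at_dom.
by congr (Omega p _); apply/funext => a; rewrite tangent_of_chart_at.
Qed.

Lemma form_local_multilinear m (Omega : diff_form M m) i x :
  multilinear (form_local Omega i x).
Proof.
move=> v k c y z; rewrite /form_local.
have E u : (fun a => tangent_of i x (dfwith v k u a)) =
    dfwith (fun a => tangent_of i x (v a)) k (tangent_of i x u).
  by rewrite -comp_dfwith.
rewrite !E -form_multilinear; congr (form _ _ (dfwith _ _ _)).
by rewrite /tangent_of linearP.
Qed.

Lemma metric_localC (g : riemannian_metric M) i x v w :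
  metric_local g i x v w = metric_local g i x w v.
Proof. exact: metric_sym. Qed.

Lemma metric_local_linl (g : riemannian_metric M) i x w :
  scalar ((metric_local g i x)^~ w).
Proof.
move=> c u v; rewrite /metric_local -metric_linear; congr (metric g _ _ _).
by rewrite /tangent_of linearP.
Qed.

Lemma metric_local_linr (g : riemannian_metric M) i x w :
  scalar (metric_local g i x w).
Proof. by move=> c u v; rewrite !(metric_localC g i x w) metric_local_linl. Qed.

Lemma metric_local_differentiable (g : riemannian_metric M) i x v w :
  image_dom i x -> differentiable (fun y => metric_local g i y v w) x.
Proof. by move=> xi; have := @metric_smooth _ _ _ g i v w [::] x; apply. Qed.

Lemma form_local_differentiable m (Omega : diff_form M m) i x v :
  image_dom i x -> differentiable (fun y => form_local Omega i y v) x.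
Proof. by move=> xi; have := @form_smooth _ _ _ _ Omega i v [::] x; apply. Qed.

Lemma derive_metric_local_lin (g : riemannian_metric M) i x w u :
  image_dom i x -> scalar (fun z => 'D_u (fun y => metric_local g i y w z) x).
Proof.
move=> xi c z z'.
have D v := differentiable_is_derive u (metric_local_differentiable g w v xi).
have H := is_deriveD (is_deriveZ c (D z)) (D z').
rewrite -[RHS](derive_val (is_derive := H)); congr ('D_u _ x).
by apply/funext => y; rewrite metric_local_linr.
Qed.

Let koszul_lin (h c a1 b1 a2 b2 a3 b3 : R) :
  h * (c * a1 + b1 + (c * a2 + b2) - (c * a3 + b3)) =
  c * (h * (a1 + a2 - a3)) + h * (b1 + b2 - b3).
Proof. ring. Qed.

Let koszul_metric (a b c : R) : a = 2^-1 * (a + b - c) + 2^-1 * (a + c - b).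
Proof. by field. Qed.

(** Christoffel symbols of the first kind: the linear form in [z] whose [sharp] is [christoffel]. *)
Definition christoffel_form (g : riemannian_metric M) i x v w z : R :=
  2^-1 * ('D_v (fun y => metric_local g i y w z) x
          + 'D_w (fun y => metric_local g i y v z) x
          - 'D_z (fun y => metric_local g i y v w) x).

Lemma christoffel_form_lin (g : riemannian_metric M) i x v w :
  image_dom i x -> scalar (christoffel_form g i x v w).
Proof.
move=> xi c z z'; rewrite /christoffel_form !(derive_metric_local_lin _ _ _ xi).
rewrite derive_scalar; last exact: metric_local_differentiable.
exact: koszul_lin.
Qed.

Lemma christoffel_formC (g : riemannian_metric M) i x v w :
  christoffel_form g i x v w = christoffel_form g i x w v.
Proof.
apply/funext => z; rewrite /christoffel_form; congr (_ * (_ - _)).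
  by rewrite addrC.
by congr ('D_z _ x); apply/funext => y; rewrite metric_localC.
Qed.

Lemma sharp_lin k (b : 'rV[R]_k -> 'rV[R]_k -> R) (l l' : 'rV[R]_k -> R) c :
  sharp b (fun z => c * l z + l' z) = c *: sharp b l + sharp b l'.
Proof.
rewrite /sharp scalemxAl -mulmxDl; congr (_ *m _).
by apply/rowP => a; rewrite !mxE.
Qed.

(** Absence of torsion, expressed in a chart. *)
Lemma christoffelC (g : riemannian_metric M) i x v w :
  christoffel g i x v w = christoffel g i x w v.
Proof.
rewrite /christoffel -[LHS]/(sharp _ (christoffel_form g i x v w)).
by rewrite christoffel_formC.
Qed.

Lemma christoffel_linl (g : riemannian_metric M) i x c u v w :
  image_dom i x -> christoffel g i x (c *: u + v) w =
    c *: christoffel g i x u w + christoffel g i x v w.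
Proof.
move=> xi; rewrite /christoffel -sharp_lin; congr sharp; apply/funext => z.
have D u' v' := metric_local_differentiable g u' v' xi.
rewrite (derive_scalar _ _ _ (D _ _)).
have E z' w' : 'D_w' (fun y => metric_local g i y (c *: u + v) z') x =
    c * 'D_w' (fun y => metric_local g i y u z') x +
    'D_w' (fun y => metric_local g i y v z') x.
  have F u' : (fun y => metric_local g i y u' z') = (fun y => metric_local g i y z' u').
    by apply/funext => y; rewrite metric_localC.
  by rewrite !F derive_metric_local_lin.
by rewrite !E; exact: koszul_lin.
Qed.

(** Compatibility with the metric: in the sum of the two Koszul expressions the derivatives in the
    directions [v] and [w] cancel. At [phi i p] the local metric is [g p], hence nondegenerate. *)
Lemma christoffel_metric (g : riemannian_metric M) p u v w :
  let i := chart_at p in let x := phi i p in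
  'D_u (fun y => metric_local g i y v w) x =
  metric_local g i x (christoffel g i x u v) w +
  metric_local g i x v (christoffel g i x u w).
Proof.
move=> i x; have xi : image_dom i x by exact/image_dom_phi/chart_at_dom.
have x_ip : inner_product (metric_local g i x).
  have -> : metric_local g i x = g p.
    by apply/funext => y; apply/funext => z; rewrite metric_local_chart_at.
  exact: riemannian_inner_product.
have gamma a b c : metric_local g i x (christoffel g i x a b) c =
    christoffel_form g i x a b c.
  exact/(sharpP x_ip)/christoffel_form_lin.
rewrite (metric_localC g i x v) !gamma /christoffel_form.
rewrite (_ : 'D_u (fun y => metric_local g i y w v) x =
  'D_u (fun y => metric_local g i y v w) x); first exact: koszul_metric.
by congr ('D_u _ x); apply/funext => y; rewrite metric_localC.
Qed.

End Charts.

(** * Immersions *)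

Section ImmersionInCharts.
Variables (R : realType) (m d : nat) (M : manifold R m) (N : manifold R d).
Variables (F : immersion M N).
Implicit Types (i : atlas M) (j : atlas N) (p : M) (x : 'rV[R]_m).

Definition coord_dom i j : set 'rV[R]_m :=
  [set x | image_dom i x /\ dom j (F (psi i x))].

Lemma coord_map_smooth i j x s : coord_dom i j x ->
  differentiable (iter_derive s (coord_map F i j)) x.
Proof.
move=> [xi xj]; apply: imm_smooth; have [q qi qx] := xi.
by rewrite -qx phiK // in xj; exists q.
Qed.

Lemma coord_map_differentiable i j x : coord_dom i j x ->
  differentiable (coord_map F i j) x.
Proof. exact: (@coord_map_smooth i j x [::]). Qed.

Lemma coord_map_image i j x : coord_dom i j x ->
  image_dom j (coord_map F i j x) /\ psi j (coord_map F i j x) = F (psi i x).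
Proof.
by move=> [xi xj]; rewrite /coord_map /= phiK //; split=> //; exact: image_dom_phi.
Qed.

Lemma near_coord_dom i j x : coord_dom i j x ->
  \forall y \near x, coord_dom i j y.
Proof.
move=> [xi xj]; have := near_psi xi (O := F @^-1` dom j).
apply => //; apply: open_comp; last exact: dom_open.
by move=> q _; exact: imm_continuous.
Qed.

Lemma coord_dom_chart_at p :
  coord_dom (chart_at p) (chart_at (F p)) (phi (chart_at p) p).
Proof.
split; first exact/image_dom_phi/chart_at_dom.
by rewrite phiK; exact: chart_at_dom.
Qed.

Lemma differentialE p X : differential F p X =
  'D_X (coord_map F (chart_at p) (chart_at (F p))) (phi (chart_at p) p).
Proof.
by rewrite deriveE //; exact/coord_map_differentiable/coord_dom_chart_at.
Qed.

(** Chain rule: both sides differentiate at [x] the map [F] read from chart [i] to the preferred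
    chart at the image point, since the intermediate changes of chart cancel near [x]. *)
Lemma differential_coord i j x Y : coord_dom i j x ->
  differential F (psi i x) (tangent_of i x Y) =
  tangent_of j (coord_map F i j x) ('D_Y (coord_map F i j) x).
Proof.
move=> xij; have [xi xj] := xij.
have [yj psiy] := coord_map_image xij.
set q := psi i x; pose c := chart_at q; pose c' := chart_at (F q).
have qc : dom c q by exact: chart_at_dom.
have Fqc' : dom c' (F q) by exact: chart_at_dom.
have df := coord_map_differentiable xij.
have dF : differentiable (coord_map F c c') ((phi c \o psi i) x).
  exact/coord_map_differentiable/coord_dom_chart_at.
have dt : differentiable (phi c \o psi i) x by exact: transition_differentiable.
have dt' : differentiable (phi c' \o psi j) (coord_map F i j x).
  by apply: transition_differentiable; rewrite ?psiy.
rewrite /differential /tangent_of -/q -/c -/c' psiy -/q -/c'.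
rewrite (deriveE _ df) -(derive_comp Y df dt') -(derive_comp Y dt dF).
apply: near_eq_derive.
have := near_psi xi (dom_open (m := M) c) qc.
apply: filterS2 (near_coord_dom xij) => z [zi zj] [_ zc].
by rewrite /coord_map /= !phiK.
Qed.

Lemma differential_linear p : linear (differential F p).
Proof. by move=> c X Y; rewrite /differential linearP. Qed.

End ImmersionInCharts.

(** * The induced metric and the normal projection *)

Section InducedMetric.
Variables (R : realType) (m d : nat) (M : manifold R m) (N : manifold R d).
Variables (g : riemannian_metric N) (F : immersion M N) (p : M).
Local Notation dF := (differential F p).
Local Notation gN := (g (F p)).

Let L : {linear 'rV[R]_m -> 'rV[R]_d} :=
  'd (coord_map F (chart_at p) (chart_at (F p))) (phi (chart_at p) p).

Lemma induced_inner_product : inner_product (induced_metric g F p).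
Proof.
exact: (pullback_inner_product (L := L) (riemannian_inner_product g (F p))
  (@imm_injective _ _ _ _ _ F p)).
Qed.

Let gN_ip := riemannian_inner_product g (F p).

(** The [sharp] in [normal_part] represents the tangential part because the induced metric is
    nondegenerate. *)
Lemma tangent_normal_split V :
  exists2 Z, V = normal_part g F p V + dF Z &
    forall Y, gN (normal_part g F p V) (dF Y) = 0.
Proof.
set Z := sharp (induced_metric g F p) (fun Y => gN V (dF Y)).
exists Z; first by rewrite subrK.
move=> Y; rewrite (scalarB (ip_linl gN_ip _)) -[X in _ - X]/(induced_metric g F p Z Y).
rewrite (sharpP induced_inner_product) ?subrr //.
by move=> c X X'; rewrite differential_linear (ip_linr gN_ip).
Qed.

Lemma normal_part_normal V Y : gN (normal_part g F p V) (dF Y) = 0.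
Proof. by have [Z _] := tangent_normal_split V. Qed.

Lemma normal_part_dual W V : (forall Y, gN W (dF Y) = 0) ->
  gN W (normal_part g F p V) = gN W V.
Proof.
have [Z VE _] := tangent_normal_split V => W_normal.
by rewrite [in RHS]VE (scalarD (ip_linr gN_ip _)) W_normal addr0.
Qed.

Lemma normal_part_linear : linear (normal_part g F p).
Proof.
move=> c U V; rewrite /normal_part.
have -> : sharp (induced_metric g F p) (fun Y => gN (c *: U + V) (dF Y)) =
    c *: sharp (induced_metric g F p) (fun Y => gN U (dF Y)) +
    sharp (induced_metric g F p) (fun Y => gN V (dF Y)).
  by rewrite -sharp_lin; congr sharp; apply/funext => Y; rewrite (ip_linl gN_ip).
by rewrite differential_linear scalerBr opprD addrACA.
Qed.

End InducedMetric.

(** * Bilinearity of the second fundamental form *)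

Section SecondFundamentalForm.
Variables (R : realType) (m d : nat) (M : manifold R m) (N : manifold R d).
Variables (g : riemannian_metric N) (F : immersion M N) (p : M).
Let i := chart_at p.
Let j := chart_at (F p).
Let f := coord_map F i j.
Let x0 := phi i p.
Local Notation B := (second_fundamental_form g F p).

(* The covariant derivative of Y along X, for X and Y with constant components
   in the preferred chart at p. *)
Definition ambient_derivative (X Y : 'rV[R]_m) : 'rV[R]_d :=
  'D_X (fun y => 'D_Y f y) x0 +
  christoffel g j (f x0) (differential F p X) (differential F p Y).

Let x0_dom : coord_dom F i j x0.
Proof. exact: coord_dom_chart_at. Qed.

Let fx0 : image_dom j (f x0).
Proof. by have [] := coord_map_image x0_dom. Qed.

Let combine c (a b a' b' : 'rV[R]_d) :
  (c *: a + a') + (c *: b + b') = c *: (a + b) + (a' + b').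
Proof. by rewrite scalerDr addrACA. Qed.

Lemma second_fundamental_form_linl Y : linear (B^~ Y).
Proof.
move=> c X X'; rewrite /second_fundamental_form -normal_part_linear.
congr (normal_part _ _ _ _).
rewrite derive_linear; last exact: (coord_map_smooth [:: Y] x0_dom).
rewrite differential_linear (christoffel_linl g _ _ _ _ fx0).
exact: combine.
Qed.

Lemma second_fundamental_form_linr X : linear (B X).
Proof.
move=> c Y Y'; rewrite /second_fundamental_form -normal_part_linear.
congr (normal_part _ _ _ _).
(* Linearity of the connection term in [Y] follows by symmetry from linearity in the other
   argument. *)
rewrite differential_linear ![christoffel _ _ _ (differential F p X) _]christoffelC.
rewrite (christoffel_linl g _ _ _ _ fx0) -combine; congr (_ + _).
have D Z : is_derive x0 X (fun y => 'D_Z f y) ('D_X (fun y => 'D_Z f y) x0).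
  exact/differentiable_is_derive/(coord_map_smooth [:: Z] x0_dom).
have H := is_deriveD (is_deriveZ c (D Y)) (D Y').
(* Additivity of ['D_Z f] in [Z] is known only where [f] is differentiable; near [x0] is enough for
   the derivative. *)
rewrite -[RHS](derive_val (is_derive := H)); apply: near_eq_derive.
apply: filterS (near_coord_dom x0_dom) => y yd.
by rewrite derive_linear //; exact: coord_map_differentiable.
Qed.

End SecondFundamentalForm.

(** * Calibrated immersions *)

Section CalibratedImmersion.
Variables (R : realType) (m d : nat) (M : manifold R m) (N : manifold R d).
Variables (g : riemannian_metric N) (Omega : diff_form N m) (F : immersion M N).
Hypotheses (Omega_comass : comass_one g Omega) (F_calibrated : calibrated g Omega F).

Lemma calibrated_normal_at q (Y : 'I_m -> 'rV[R]_m) k u :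
  (forall X, g (F q) u (differential F q X) = 0) ->
  Omega (F q) (dfwith (differential F q \o Y) k u) = 0.
Proof.
pose L : {linear 'rV[R]_m -> 'rV[R]_d} :=
  'd (coord_map F (chart_at q) (chart_at (F q))) (phi (chart_at q) q).
apply: (@calibrated_normal _ _ _ (g (F q)) L (Omega (F q))).
- exact: riemannian_inner_product.
- exact: imm_injective.
- exact: form_multilinear.
- exact: form_alternating.
- by have [] := Omega_comass (F q).
- by move=> e e_on e_pos; apply: F_calibrated.
Qed.

(* Cramer's rule for the tangential part of u, stated without inverting the
   Gram matrix so that it can be differentiated along F. *)
Lemma calibrated_cramer_at q (E : 'I_m -> 'rV[R]_m) u b :
  (forall Z, exists c, Z = \sum_a c a *: E a) ->
  forall v, v = differential F q \o E ->
  \sum_k Omega (F q) (dfwith v k u) * g (F q) (v k) (v b) =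
  g (F q) u (v b) * Omega (F q) v.
Proof.
move=> E_span v vE; set w := Omega (F q); set h := g (F q).
have w_lin : multilinear w by exact: form_multilinear.
have w_alt : alternating w by exact: form_alternating.
have h_ip : inner_product h by exact: riemannian_inner_product.
have [Z uE u_normal] := tangent_normal_split g F q u.
have [c ZE] := E_span Z.
pose n := normal_part g F q u.
have dFZ : differential F q Z = \sum_a c a *: v a.
  rewrite ZE vE /= /differential linear_sum; apply: eq_bigr => a _.
  by rewrite linearZ.
have slot0 k : w (dfwith v k n) = 0 by rewrite vE; exact: calibrated_normal_at.
(* The normal part of [u] contributes zero; of its tangential components only the one along [v k]
   survives, the others repeating a vector. *)
have slot k : w (dfwith v k u) = c k * w v.
  rewrite uE (scalarD (multilinear_dfwithP _ _ w_lin)) (slot0 k) add0r.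
  rewrite dFZ (scalar_sum (multilinear_dfwithP _ _ w_lin)) (bigD1 k) //= big1.
    by rewrite addr0 dfwith_id.
  by move=> a ak; rewrite (alternating_dup w_alt (j := a)) ?mulr0 // eq_sym.
have -> : h u (v b) = \sum_k c k * h (v k) (v b).
  have n_v : h n (v b) = 0 by rewrite vE; exact: u_normal.
  rewrite uE (scalarD (ip_linl h_ip _)) -/n n_v add0r dFZ.
  by rewrite (scalar_sum (ip_linl h_ip _)).
rewrite mulr_suml; apply: eq_bigr => k _; rewrite slot; ring.
Qed.

Variables (p : M) (e : 'I_m -> 'rV[R]_m).
Hypothesis e_frame : direct_orthonormal_frame g F p e.
Let i := chart_at p.
Let j := chart_at (F p).
Let f := coord_map F i j.
Let v (x : 'rV[R]_m) (a : 'I_m) := 'D_(e a) f x.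

(** The pointwise identity, transported to charts for the coordinate frame field [v]. It holds
    throughout the coordinate domain, with [u] of constant components, and can therefore be
    differentiated. *)
Lemma calibrated_cramer x u b : coord_dom F i j x ->
  \sum_k form_local Omega j (f x) (dfwith (v x) k u) *
    metric_local g j (f x) (v x k) (v x b) =
  metric_local g j (f x) u (v x b) * form_local Omega j (f x) (v x).
Proof.
move=> xij; have [xi xj] := xij.
have [yj psiy] := coord_map_image xij.
pose E a := tangent_of i x (e a).
have span Z : exists c, Z = \sum_a c a *: E a.
  have [Y <-] := tangent_of_surjective xi Z.
  exists (fun a => induced_metric g F p Y (e a)).
  rewrite {1}(orthonormal_expansion (induced_inner_product g F p) Y e_frame.1).
  by rewrite /tangent_of linear_sum; apply: eq_bigr => a _; rewrite linearZ.
have := @calibrated_cramer_at (psi i x) E (tangent_of j (f x) u) b span.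
have vE : (fun a => tangent_of j (f x) (v x a)) = differential F (psi i x) \o E.
  by apply/funext => a /=; apply/esym; exact: differential_coord.
rewrite /metric_local /form_local psiy => /(_ _ vE) <-.
by apply: eq_bigr => k _; rewrite -comp_dfwith.
Qed.

End CalibratedImmersion.

(** * Differentiation of the form and of the metric along the immersion *)

Section CovariantDerivative.
Variables (R : realType) (m d : nat) (M : manifold R m) (N : manifold R d).
Variables (g : riemannian_metric N) (F : immersion M N) (p : M) (X : 'rV[R]_m).
Let i := chart_at p.
Let j := chart_at (F p).
Let f := coord_map F i j.
Let x0 := phi i p.

(** Zeroth-order term of the connection pulled back by [F]: the covariant derivative along [X] of a
    field with value [u] and coordinate derivative [u'] is [u' + christoffel_along u]. *)
Definition christoffel_along (u : 'rV[R]_d) : 'rV[R]_d :=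
  christoffel g j (f x0) (differential F p X) u.

Let fx0E : f x0 = phi j (F p).
Proof. by rewrite /f /coord_map /= phiK //; exact: chart_at_dom. Qed.

Let x0_dom : coord_dom F i j x0.
Proof. exact: coord_dom_chart_at. Qed.

Let fx0 : image_dom j (f x0).
Proof. by have [] := coord_map_image x0_dom. Qed.

Let f_diff : differentiable f x0.
Proof. exact: coord_map_differentiable. Qed.

(** As the form is parallel, the derivatives of its coefficients turn the coordinate derivatives of
    the arguments into covariant ones. *)
Lemma is_derive_form_along r (Omega : diff_form N r) (Omega_parallel : parallel g Omega)
    (u : 'I_r -> 'rV[R]_m -> 'rV[R]_d) (u' : 'I_r -> 'rV[R]_d) :
  (forall a, is_derive x0 X (u a) (u' a)) ->
  is_derive x0 X (fun x => form_local Omega j (f x) (u^~ x))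
    (\sum_a Omega (F p)
      (dfwith (u^~ x0) a (u' a + christoffel_along (u a x0)))).
Proof.
move=> du.
pose dw v := \sum_(a < r) Omega (F p) (dfwith v a (christoffel_along (v a))).
have OmE v : form_local Omega j (f x0) v = Omega (F p) v.
  by rewrite fx0E form_local_chart_at.
have w_derive v :
    is_derive x0 X (fun x => form_local Omega j (f x) v) (dw v).
  have H := is_derive_comp X f_diff (form_local_differentiable Omega v fx0).
  apply: (is_derive_ext H) => //; rewrite -differentialE Omega_parallel //.
  by apply: eq_bigr => a _; rewrite OmE.
have w_lin x : multilinear (form_local Omega j (f x)).
  exact: form_local_multilinear.
apply: (is_derive_ext (is_derive_multilinear w_lin w_derive du)) => //.
rewrite /dw -big_split /=; apply: eq_bigr => a _; rewrite OmE [LHS]addrC.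
by rewrite (scalarD (multilinear_dfwithP _ _ (@form_multilinear _ _ _ _ Omega _))).
Qed.

Lemma is_derive_metric_along (u w : 'rV[R]_m -> 'rV[R]_d) (u' w' : 'rV[R]_d) :
  is_derive x0 X u u' -> is_derive x0 X w w' ->
  is_derive x0 X (fun x => metric_local g j (f x) (u x) (w x))
    (g (F p) (u' + christoffel_along (u x0)) (w x0) +
     g (F p) (u x0) (w' + christoffel_along (w x0))).
Proof.
move=> du dw.
(* The metric is regarded as a multilinear function of two slots, so that the general product rule
   applies. *)
pose G x (v : 'I_2 -> 'rV[R]_d) := metric_local g j (f x) (v ord0) (v ord_max).
have G_lin x : multilinear (G x).
  move=> v a c y z; rewrite /G !dfwithE.
  by case: (unliftP ord0 a) => [b ->|->] /=;
    rewrite ?ord1 /= ?metric_local_linl ?metric_local_linr.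
have gE v z : metric_local g j (f x0) v z = g (F p) v z.
  by rewrite fx0E metric_local_chart_at.
have dG v : is_derive x0 X (G^~ v)
    (g (F p) (christoffel_along (v ord0)) (v ord_max) +
     g (F p) (v ord0) (christoffel_along (v ord_max))).
  have H := is_derive_comp X f_diff
    (metric_local_differentiable g (v ord0) (v ord_max) fx0).
  apply: (is_derive_ext H) => //; rewrite -differentialE.
  by rewrite -!gE fx0E christoffel_metric -fx0E.
pose s (a : 'I_2) := if a == ord0 then u else w.
pose s' (a : 'I_2) := if a == ord0 then u' else w'.
have ds a : is_derive x0 X (s a) (s' a) by rewrite /s /s'; case: eqP.
apply: (is_derive_ext (is_derive_multilinear G_lin dG ds)) => //.
rewrite !big_ord_recl big_ord0 /G !dfwithE /s /s' /= !gE addr0.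
have ip := riemannian_inner_product g (F p).
rewrite (scalarD (ip_linl ip _)) (scalarD (ip_linr ip _)).
by rewrite [LHS]addrC [LHS]addrACA.
Qed.

End CovariantDerivative.

(** * A linear identity for the second fundamental form *)

Section CalibratedSecondFundamentalForm.
Variables (R : realType) (m d : nat) (M : manifold R m) (N : manifold R d).
Variables (g : riemannian_metric N) (Omega : diff_form N m) (F : immersion M N).
Hypotheses (Omega_comass : comass_one g Omega) (F_calibrated : calibrated g Omega F).
Hypothesis Omega_parallel : parallel g Omega.
Variables (p : M) (e : 'I_m -> 'rV[R]_m).
Hypothesis e_frame : direct_orthonormal_frame g F p e.
Let i := chart_at p.
Let j := chart_at (F p).
Let f := coord_map F i j.
Let x0 := phi i p.
Local Notation dF := (differential F p).
Local Notation gN := (g (F p)).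
Local Notation Om := (Omega (F p)).
Local Notation B := (second_fundamental_form g F p).

(** This is the derivative of [calibrated_cramer] at [x0] along [X], with [u] extended by constant
    components in the chart. *)
Lemma calibrated_second_fundamental_form X u b :
  (forall Y, gN u (dF Y) = 0) ->
  gN u (B X (e b)) =
  \sum_(l | l != b) Om (dfwith (dfwith (dF \o e) b u) l (B X (e l))).
Proof.
move=> u_normal.
have x0_dom : coord_dom F i j x0 by exact: coord_dom_chart_at.
have Om_lin : multilinear Om by exact: form_multilinear.
have Om_alt : alternating Om by exact: form_alternating.
have gN_ip : inner_product gN by exact: riemannian_inner_product.
have fx0E : f x0 = phi j (F p).
  by rewrite /f /coord_map /= phiK //; exact: chart_at_dom.
have OmE v : form_local Omega j (f x0) v = Om v by rewrite fx0E form_local_chart_at.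
have gE v z : metric_local g j (f x0) v z = gN v z.
  by rewrite fx0E metric_local_chart_at.
pose v a x := 'D_(e a) f x.
pose v' a := 'D_X (v a) x0.
have dv a : is_derive x0 X (v a) (v' a).
  exact/differentiable_is_derive/(coord_map_smooth [:: e a] x0_dom).
have vE : v^~ x0 = dF \o e.
  by apply/funext => a; rewrite /= differentialE.
have vEa a : v a x0 = dF (e a) by rewrite differentialE.
pose nabla := christoffel_along g F p X.
have e_span Z : exists c, Z = \sum_a c a *: e a.
  exists (fun a => induced_metric g F p Z (e a)).
  exact: (orthonormal_expansion (induced_inner_product g F p) Z e_frame.1).
have normal_slot k : Om (dfwith (dF \o e) k u) = 0.
  exact: (calibrated_normal_at Omega_comass F_calibrated).
have Om1 : Om (dF \o e) = 1 by exact: F_calibrated.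
have g_on a c : gN (dF (e a)) (dF (e c)) = (a == c)%:R by exact: e_frame.1.
have slot z : Om (dfwith (dF \o e) b z) = gN z (dF (e b)).
  have := calibrated_cramer_at Omega_comass F_calibrated z b e_span (erefl (dF \o e)).
  rewrite Om1 mulr1 => <-; rewrite (bigD1 b) //= g_on eqxx mulr1 big1 ?addr0 //.
  by move=> k kb; rewrite g_on (negPf kb) mulr0.
pose w k a x := if a == k then u else v a x.
pose w' k a := if a == k then 0 else v' a.
have dw k a : is_derive x0 X (w k a) (w' k a).
  by rewrite /w /w'; case: eqP => _ //; exact: is_derive_cst.
have wE k x : (w k)^~ x = dfwith (v^~ x) k u.
  by apply/funext => a; rewrite dfwithE.
pose A k x := form_local Omega j (f x) ((w k)^~ x).
pose G k x := metric_local g j (f x) (v k x) (v b x).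
pose P x := metric_local g j (f x) u (v b x).
pose O x := form_local Omega j (f x) (v^~ x).
have dA k := is_derive_form_along F Omega_parallel (dw k).
have dG k := is_derive_metric_along g F (dv k) (dv b).
have dP := is_derive_metric_along g F (is_derive_cst u x0 X) (dv b).
have dO := is_derive_form_along F Omega_parallel dv.
have H0 : \forall x \near x0, \sum_k A k x * G k x - P x * O x = 0.
  apply: filterS (near_coord_dom x0_dom) => x xd; apply/eqP; rewrite subr_eq0.
  rewrite -(calibrated_cramer Omega_comass F_calibrated e_frame u b xd).
  by apply/eqP/eq_bigr => k _; rewrite /A wE.
have dH := is_deriveB (is_derive_fun_sum (fun k => is_deriveM (dA k) (dG k)))
  (is_deriveM dP dO).
have E := derive_val (is_derive := dH).
rewrite (@near_eq_derive _ _ _ _ (cst 0)) // derive_cst in E.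
(* At [x0] the frame is orthonormal and [u] is normal: [A k] and [P] vanish, [G k] is a Kronecker
   delta and [O] is 1. Only the derivatives of [A b] and [P] remain. *)
have Ax0 k : form_local Omega j (f x0) ((w k)^~ x0) = 0.
  by rewrite OmE wE vE normal_slot.
have Px0 : metric_local g j (f x0) u (v b x0) = 0 by rewrite gE vEa u_normal.
move: E; rewrite Px0 OmE vE Om1 scale0r scale1r add0r.
rewrite (bigD1 b) //= [X in _ + X - _]big1; last first.
  by move=> k kb; rewrite Ax0 gE !vEa g_on (negPf kb) !scale0r addr0.
rewrite Ax0 gE !vEa g_on eqxx scale0r scale1r add0r addr0 add0r.
pose nab l := ambient_derivative g F p X (e l).
have nabE l : v' l + nabla (dF (e l)) = nab l by [].
move=> E'; have {E'} : \sum_a Om (dfwith ((w b)^~ x0) a (w' b a + nabla (w b a x0))) =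
    gN (nabla u) (dF (e b)) + gN u (nab b).
  by apply/eqP; rewrite -subr_eq0; apply/eqP/esym; exact: E'.
have wb : w b b x0 = u by rewrite /w eqxx.
have w'b : w' b b = 0 by rewrite /w' eqxx.
(* In the term of slot [b], [u] is replaced by its covariant derivative [nabla u]; by [slot] it
   cancels against the same term on the right. *)
rewrite (bigD1 b) //= w'b wb add0r wE dfwith_same vE slot => /addrI E.
rewrite -[B X (e b)]/(normal_part g F p (nab b)) normal_part_dual // -E.
apply: eq_bigr => l lb; rewrite /w' /w (negPf lb) vEa nabE.
(* The tangential part of [nab l] contributes nothing because slot [b] still holds the normal vector
   [u]. *)
have [Z -> _] := tangent_normal_split g F p (nab l).
rewrite -[normal_part _ _ _ _]/(B X (e l)).
rewrite (scalarD (multilinear_dfwithP _ _ Om_lin)) [X in _ + X](_ : _ = 0) ?addr0 //.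
rewrite dfwith_comm 1?eq_sym // -comp_dfwith.
exact: (calibrated_normal_at Omega_comass F_calibrated).
Qed.

End CalibratedSecondFundamentalForm.

(** The two triangles contribute equally by symmetry; this is the origin of the factor 2 in
    [Qtilde]. *)
Lemma sum_offdiag (R : realType) m (S : 'I_m -> 'I_m -> R) :
  (forall k l, k != l -> S k l = S l k) ->
  \sum_k \sum_(l | l != k) S k l = 2 * \sum_(l < m) \sum_(k < m | (l < k)%N) S k l.
Proof.
move=> SC; set U := \sum_(l < m) _.
have split k : \sum_(l | l != k) S k l =
    \sum_(l < m | (l < k)%N) S k l + \sum_(l < m | (k < l)%N) S k l.
  rewrite (bigID (fun l : 'I_m => (l < k)%N)) /=; congr (_ + _);
  by apply: eq_bigl => l; rewrite -val_eqE /=; case: ltngtP.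
rewrite (eq_bigr _ (fun k _ => split k)) big_split /=.
rewrite mulr_natl mulr2n; congr (_ + _).
  rewrite (exchange_big_dep predT) //=.
apply: eq_bigr => l _; apply: eq_bigr => k lk.
by apply: SC; rewrite -val_eqE ltn_eqF.
Qed.

(** * The quadratic forms in a calibrated frame *)

Section CalibratedFrame.
Variables (R : realType) (m d : nat) (M : manifold R m) (N : manifold R d).
Variables (g : riemannian_metric N) (Omega : diff_form N m) (F : immersion M N).
Hypotheses (Omega_comass : comass_one g Omega) (F_calibrated : calibrated g Omega F).
Hypothesis Omega_parallel : parallel g Omega.
Variables (p : M) (e : 'I_m -> 'rV[R]_m).
Hypothesis e_frame : direct_orthonormal_frame g F p e.
Local Notation dF := (differential F p).
Local Notation gN := (g (F p)).
Local Notation Om := (Omega (F p)).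
Local Notation B := (second_fundamental_form g F p).

Let Om_lin : multilinear Om. Proof. exact: form_multilinear. Qed.
Let Om_alt : alternating Om. Proof. exact: form_alternating. Qed.
Let gN_ip : inner_product gN. Proof. exact: riemannian_inner_product. Qed.

Let e_on a b : induced_metric g F p (e a) (e b) = (a == b)%:R.
Proof. exact: e_frame.1. Qed.

Lemma form_star1_slots U X : form_star1 g Omega F p e U X =
  \sum_i induced_metric g F p X (e i) * Om (dfwith (dF \o e) i U).
Proof. by apply: eq_bigr => i _; rewrite (evals_slot1 Om_lin Om_alt). Qed.

(** Of the double sum only the pair [(a, b)] survives; the transposed pair is excluded by
    [i < k]. *)
Lemma form_star2_frame (a b : 'I_m) U W : (a < b)%N ->
  form_star2 g Omega F p e U W (e a) (e b) =
  Om (dfwith (dfwith (dF \o e) b W) a U).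
Proof.
move=> ab; rewrite (evals_slot2 Om_lin Om_alt) // /form_star2.
rewrite (bigD1 a) //= (bigD1 b) //= !e_on !eqxx.
have -> : (a == b) = false by rewrite -val_eqE ltn_eqF.
rewrite mul0r subr0 !mul1r big1 ?addr0 => [|k /andP [ak kb]]; last first.
  rewrite !e_on [b == k]eq_sym (negPf kb) -[a == k]val_eqE (ltn_eqF ak).
  by rewrite !(mulr0, mul0r) subr0 mul0r.
rewrite big1 ?addr0 // => i ia; rewrite big1 // => k ik.
rewrite !e_on [a == i]eq_sym (negPf ia) mul0r sub0r.
case: (eqVneq a k) => [ak|_]; last by rewrite mul0r oppr0 mul0r.
case: (eqVneq b i) => [bi|_]; last by rewrite mulr0 oppr0 mul0r.
by move: ik; rewrite -ak -bi ltnNge ltnW.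
Qed.

Lemma form_star1_normal U X : (forall Y, gN U (dF Y) = 0) ->
  form_star1 g Omega F p e U X = 0.
Proof.
move=> U_normal; rewrite form_star1_slots big1 // => i _.
by rewrite (calibrated_normal_at Omega_comass F_calibrated) ?mulr0.
Qed.

(** [B] is normal, so its pairing with [Phi] is [form_star1] on a normal vector, which vanishes. *)
Lemma normsq_B_Phi_calibrated : normsq_B_Phi g Omega F p e B = 0.
Proof.
rewrite /normsq_B_Phi big1 // => i _; rewrite /B_Phi big1 ?expr0n // => k _.
have B_normal Y : gN (B (e k) (e i)) (dF Y) = 0 by exact: normal_part_normal.
rewrite normal_part_dual // (ip_sym gN_ip) (sharpP gN_ip) ?form_star1_normal //.
move=> c U V; rewrite !form_star1_slots mulr_sumr -big_split /=.
apply: eq_bigr => l _; rewrite (multilinear_dfwithP _ _ Om_lin) /=.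
rewrite mulrDr; congr (_ + _); exact: mulrCA.
Qed.

Lemma cos_angle_calibrated : cos_angle Omega F p e = 1.
Proof. exact: F_calibrated. Qed.

Let T a k l := Om (dfwith (dfwith (dF \o e) k (B (e a) (e k))) l (B (e a) (e l))).

Let Psi_wedge2E : Psi_wedge2 g Omega F p e B =
  \sum_(l < m) \sum_(k < m | (l < k)%N) \sum_a T a k l.
Proof.
apply: eq_bigr => l _; apply: eq_bigr => k lk; apply: eq_bigr => a _.
exact: form_star2_frame.
Qed.

(** The linear identity is applied with [u = B (e a) (e k)] itself, then summed over [a] and [k];
    exchanging [k] and [l] fills the same two slots with the same vectors. *)
Lemma normsq_calibrated :
  normsq g F p e B = 2 * Psi_wedge2 g Omega F p e B.
Proof.
have TC a k l : k != l -> T a k l = T a l k.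
  by move=> kl; exact: (congr1 Om (dfwith_comm _ _ _ kl)).
have -> : normsq g F p e B = \sum_k \sum_(l | l != k) \sum_a T a k l.
  rewrite /normsq exchange_big; apply: eq_bigr => k _ /=.
  rewrite [RHS]exchange_big; apply: eq_bigr => a _ /=.
  rewrite (calibrated_second_fundamental_form Omega_comass F_calibrated) //.
  by move=> Y; exact: normal_part_normal.
rewrite Psi_wedge2E; apply: sum_offdiag => k l kl.
by apply: eq_bigr => a _; exact: TC.
Qed.

Lemma Qtilde_calibrated : Qtilde g Omega F p e B = 0.
Proof.
by rewrite /Qtilde cos_angle_calibrated divr1 normsq_calibrated subrr.
Qed.

Lemma Q_calibrated : Q g Omega F p e B = 0.
Proof. by rewrite /Q Qtilde_calibrated normsq_B_Phi_calibrated mul0r addr0. Qed.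

(** In codimension one the two normal vectors in each term are collinear, so alternation kills it;
    the case [u = 0] is separate because a direction is needed. *)
Lemma Psi_wedge2_hypersurface : d = m.+1 ->
  Psi_wedge2 g Omega F p e B = 0.
Proof.
move=> dE; rewrite Psi_wedge2E big1 // => l _; rewrite big1 // => k lk.
rewrite big1 // => a _; rewrite /T.
have kl : k != l by rewrite -val_eqE gtn_eqF.
set u := B (e a) (e k); set w := B (e a) (e l).
have [->|u0] := eqVneq u 0.
  rewrite dfwith_comm //.
  exact: (scalar0 (multilinear_dfwithP _ k Om_lin)).
have dFe_on : orthonormal gN (dF \o e) by exact: e_frame.1.
have [c ->] : exists c, w = c *: u.
  apply: (orthogonal_hyperplane_collinear dE gN_ip dFe_on u0) => b;
  exact: normal_part_normal.
rewrite (scalarZ (multilinear_dfwithP _ _ Om_lin)).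
by rewrite (alternating_dup Om_alt (j := k)) ?mulr0 ?dfwithin // eq_sym.
Qed.

Lemma normsq_ge0 : 0 <= normsq g F p e B.
Proof. by do 2!apply: sumr_ge0 => ? _; exact: ip_ge0. Qed.

Lemma normsq_eq0 : normsq g F p e B = 0 -> forall X Y, B X Y = 0.
Proof.
move=> /psumr_eq0P sum0 X Y.
have Be a b : B (e a) (e b) = 0.
  apply: (ip_eq0 gN_ip); move: b (erefl true); apply/psumr_eq0P.
    by move=> *; exact: ip_ge0.
  by apply: sum0 => // ? _; apply: sumr_ge0 => ? _; exact: ip_ge0.
have ex Z := orthonormal_expansion (induced_inner_product g F p) Z e_frame.1.
have lin_eq0 (L : 'rV[R]_m -> 'rV[R]_d) Z :
    linear L -> (forall a, L (e a) = 0) -> L Z = 0.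
  move=> L_lin L0.
  have L00 : L 0 = 0.
    by have := L_lin (-1) 0 0; rewrite scaler0 addr0 scaleN1r addNr.
  rewrite (ex Z); elim/big_ind: _ => [//|x y Lx Ly|a _].
    by rewrite -[x]scale1r L_lin Lx Ly scaler0 addr0.
  by rewrite -[_ *: _]addr0 L_lin L0 L00 scaler0 addr0.
apply: (lin_eq0 (B^~ Y)) => [|a]; first exact: second_fundamental_form_linl.
by apply: lin_eq0 => [|b]; first exact: second_fundamental_form_linr.
Qed.

End CalibratedFrame.

(** * Vanishing of [Q] and total geodesy *)

Theorem proposition1p3 (R : realType) (m n : nat) (hm : (2 <= m)%N)
  (Mbar : manifold R (m + n)) (g : riemannian_metric Mbar)
  (Omega : diff_form Mbar m)
  (Omega_calibration : calibration g Omega) (Omega_parallel : parallel g Omega)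
  (M : manifold R m) (M_oriented : oriented_atlas M) (F : immersion M Mbar)
  (F_calibrated : calibrated g Omega F) :
  let B := second_fundamental_form g F in
  [/\ forall p e, direct_orthonormal_frame g F p e ->
        Q g Omega F p e (B p) = 0 /\ Qtilde g Omega F p e (B p) = 0,
      (exists delta : R, delta_positive g Omega F delta B) ->
        totally_geodesic g F
    & n = 1%N ->
        (exists delta : R, delta_positive g Omega F delta B) /\
        totally_geodesic g F].
Proof.
move=> B; have [_ comass] := Omega_calibration.
(* Positivity is stated for direct orthonormal frames, so one is needed at each point to draw a
   conclusion on [B]. *)
have frame p : exists e, direct_orthonormal_frame g F p e.
  exact: (direct_orthonormal_exists (induced_inner_product g F p)).
have geodesic : (exists delta : R, delta_positive g Omega F delta B) ->
    totally_geodesic g F.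
  move=> [delta [delta0 pos]] p X Y; have [e e_frame] := frame p.
  apply: (normsq_eq0 e_frame); apply/eqP; rewrite eq_le normsq_ge0 andbT.
  (* Positivity becomes [delta ||B||^2 <= 0] with [delta > 0]. *)
  have := pos p e e_frame; rewrite Q_calibrated //.
  by rewrite pmulr_rle0.
split=> // [p e e_frame|n1]; first by rewrite Q_calibrated // Qtilde_calibrated.
suff pos : exists delta : R, delta_positive g Omega F delta B.
  by split=> //; exact: geodesic.
(* Any positive constant would do: [Q] and [||B||^2] both vanish in codimension one. *)
exists 1; split=> // p e e_frame; rewrite Q_calibrated // mul1r.
rewrite (normsq_calibrated comass F_calibrated Omega_parallel e_frame).
by rewrite Psi_wedge2_hypersurface ?mulr0 // n1 addn1.
Qed.
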